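(* Let $E$ be a $\Pi^1_1$ equivalence relation on $\mathcal{N}$. Then $\mathcal{N}$ decomposes as a disjoint union $\mathcal{N}=H\oplus Z$ of two $\mathcal{S}$-clopen subspaces $H$ and $Z$ such that $E_H=E\cap(H\times H)$ is clopen in $H\times H$, and $E_Z=E\cap(Z\times Z)$ is meager in $Z\times Z$, where $H\times H$ and $Z\times Z$ carry the topologies induced by the product topology $\mathcal{S}\times\mathcal{S}$.
   Context: $\mathcal{N}=\omega^\omega$ is the Baire space. $\Sigma^1_1$, $\Pi^1_1$, $\Delta^1_1$ denote the lightface (effective, parameter-free) classes of subsets of $\mathcal{N}$ or $\mathcal{N}^2$; an equivalence relation on $\mathcal{N}$ is $\Pi^1_1$ if it is so as a subset of $\mathcal{N}^2$. The $\Delta$-topology $\mathcal{S}_\Delta$ is the topology on $\mathcal{N}$ with basis the $\Delta^1_1$ subsets of $\mathcal{N}$. The $\Sigma\Delta$-topology, denoted $\mathcal{S}$, is the topology on $\mathcal{N}$ with basis the $\Sigma^1_1$ subsets of $\mathcal{N}$ that are $\mathcal{S}_\Delta$-closed (a set $A\subseteq\mathcal{N}$ is $\mathcal{S}_\Delta$-closed iff $A=\bigcap\{D\in\Delta^1_1 : D\supseteq A\}$). $\mathcal{S}\times\mathcal{S}$ is the usual product topology on $\mathcal{N}^2$. Either of the two subspaces $H$, $Z$ is allowed to be empty. *)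

(* Defs.v *)
From HB Require Import structures.
From mathcomp Require Import all_boot all_order all_algebra.
From mathcomp Require Import all_classical all_reals all_analysis.

Set Implicit Arguments.
Unset Strict Implicit.
Unset Printing Implicit Defensive.

Local Open Scope classical_set_scope.
Local Open Scope nat_scope.

Definition baire : Type := nat -> nat.

(* Arithmetical formulas of second-order arithmetic: number quantifiers only,
   with function variables occurring free.  Number variables are de Bruijn
   indices; the i-th function variable names the i-th entry of the function
   environment.  The remaining connectives, the existential quantifier and
   the order are classical abbreviations. *)
Inductive term : Type :=
| tVar of nat
| tZero
| tSucc of term
| tAdd of term & term
| tMul of term & term
| tApp of nat & term.

Inductive formula : Type :=
| fEq of term & term
| fNot of formula
| fAnd of formula & formula
| fAll of formula.

(* Variables beyond the environment denote 0 or the zero function, so that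
   they do not act as parameters. *)
Fixpoint eval (fs : seq baire) (e : seq nat) (t : term) : nat :=
  match t with
  | tVar i => nth 0 e i
  | tZero => 0
  | tSucc t1 => (eval fs e t1).+1
  | tAdd t1 t2 => eval fs e t1 + eval fs e t2
  | tMul t1 t2 => eval fs e t1 * eval fs e t2
  | tApp i t1 => nth (fun=> 0) fs i (eval fs e t1)
  end.

Fixpoint sat (fs : seq baire) (e : seq nat) (p : formula) : Prop :=
  match p with
  | fEq t1 t2 => eval fs e t1 = eval fs e t2
  | fNot p1 => ~ sat fs e p1
  | fAnd p1 p2 => sat fs e p1 /\ sat fs e p2
  | fAll p1 => forall n, sat fs (n :: e) p1
  end.

(* [pt] lists the coordinates of a point; function variable 0 is the
   quantified one, and the coordinates are variables 1, 2, and so on. *)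
Definition Sigma11_at (X : Type) (pt : X -> seq baire) (A : set X) : Prop :=
  exists p : formula, forall x, A x <-> exists w : baire, sat (w :: pt x) [::] p.

Definition Sigma11 (A : set baire) : Prop := Sigma11_at (fun x => [:: x]) A.

Definition Delta11 (A : set baire) : Prop := Sigma11 A /\ Sigma11 (~` A).

Definition Sigma11_2 (A : set (baire * baire)) : Prop :=
  Sigma11_at (fun x => [:: x.1; x.2]) A.

Definition Pi11_2 (A : set (baire * baire)) : Prop := Sigma11_2 (~` A).

Definition nowhere_dense (T : topologicalType) (A : set T) : Prop :=
  interior (closure A) = set0.

Definition meager (T : topologicalType) (A : set T) : Prop :=
  exists F : nat -> set T,
    (forall n, nowhere_dense (F n)) /\ A `<=` \bigcup_n F n.

(* Splitting one function w into n |-> w (2n) and n |-> w (2n + 1), to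
   contract two function quantifiers into one. *)
Fixpoint half_term (b : bool) (t : term) : term :=
  match t with
  | tVar i => tVar i
  | tZero => tZero
  | tSucc t1 => tSucc (half_term b t1)
  | tAdd t1 t2 => tAdd (half_term b t1) (half_term b t2)
  | tMul t1 t2 => tMul (half_term b t1) (half_term b t2)
  | tApp 0 t1 => let u := half_term b t1 in
      tApp 0 (if b then tSucc (tAdd u u) else tAdd u u)
  | tApp i t1 => tApp i (half_term b t1)
  end.

Fixpoint half_formula (b : bool) (p : formula) : formula :=
  match p with
  | fEq t1 t2 => fEq (half_term b t1) (half_term b t2)
  | fNot p1 => fNot (half_formula b p1)
  | fAnd p1 p2 => fAnd (half_formula b p1) (half_formula b p2)
  | fAll p1 => fAll (half_formula b p1)
  end.

Lemma eval_half (b : bool) (w : baire) (fs : seq baire) (e : seq nat) t :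
  eval (w :: fs) e (half_term b t) = eval ((fun n => w (b + n.*2)) :: fs) e t.
Proof.
elim: t => //= [t -> //|t1 -> t2 -> //|t1 -> t2 -> //|[|i] t <- //=].
by case: b => /=; rewrite addnn.
Qed.

Lemma sat_half (b : bool) (w : baire) (fs : seq baire) p (e : seq nat) :
  sat (w :: fs) e (half_formula b p) <-> sat ((fun n => w (b + n.*2)) :: fs) e p.
Proof.
elim: p e => /= [t1 t2|p IH|p IHp q IHq|p IH] e.
- by rewrite !eval_half.
- by rewrite IH.
- by rewrite IHp IHq.
- by split=> h n; apply/IH; exact: h.
Qed.

Lemma Sigma11T : Sigma11 setT.
Proof.
by exists (fEq tZero tZero) => x; split=> // _; exists (fun=> 0).
Qed.

Lemma Sigma11_0 : Sigma11 set0.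
Proof.
by exists (fNot (fEq tZero tZero)) => x; split=> // -[w] /=; apply.
Qed.

Lemma Sigma11I (A B : set baire) : Sigma11 A -> Sigma11 B -> Sigma11 (A `&` B).
Proof.
move=> [p Ap] [q Bq]; exists (fAnd (half_formula false p) (half_formula true q)) => x; split.
  move=> [/Ap[u pu] /Bq[v qv]].
  exists (fun n => if odd n then v n./2 else u n./2); split; apply/sat_half.
    suff -> : (fun n => if odd (false + n.*2) then v (false + n.*2)./2
      else u (false + n.*2)./2) = u by [].
    by apply/funext => n; rewrite add0n odd_double doubleK.
  suff -> : (fun n => if odd (true + n.*2) then v (true + n.*2)./2
    else u (true + n.*2)./2) = v by [].
  by apply/funext => n; rewrite oddD odd_double half_bit_double.
move=> [w /= [/sat_half pw /sat_half qw]].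
by split; [apply/Ap|apply/Bq]; eexists; eassumption.
Qed.

Lemma Sigma11U (A B : set baire) : Sigma11 A -> Sigma11 B -> Sigma11 (A `|` B).
Proof.
move=> [p Ap] [q Bq]; exists (fNot (fAnd (fNot p) (fNot q))) => x; split.
  move=> [/Ap[w pw]|/Bq[w qw]]; exists w => /= -[].
    by move=> /(_ pw).
  by move=> _ /(_ qw).
move=> [w /= /not_andP[/contrapT pw|/contrapT qw]].
  by left; apply/Ap; exists w.
by right; apply/Bq; exists w.
Qed.

Lemma Delta11T : Delta11 setT.
Proof. by split; rewrite ?setCT; [exact: Sigma11T|exact: Sigma11_0]. Qed.

Lemma Delta11I (A B : set baire) : Delta11 A -> Delta11 B -> Delta11 (A `&` B).
Proof.
move=> [A1 A2] [B1 B2]; split; first exact: Sigma11I.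
by rewrite setCI; exact: Sigma11U.
Qed.

Definition baire_Delta : Type := baire.

HB.instance Definition _ := gen_eqMixin baire_Delta.
HB.instance Definition _ := gen_choiceMixin baire_Delta.

Lemma Delta_cover : \bigcup_(A in Delta11) A = [set: baire_Delta].
Proof. by apply/seteqP; split=> // x _; exists setT => //; exact: Delta11T. Qed.

Lemma Delta_join (A B : set baire_Delta) (x : baire_Delta) :
  Delta11 A -> Delta11 B -> A x -> B x ->
  exists C : set baire_Delta, [/\ Delta11 C, C x & C `<=` A `&` B].
Proof. by move=> dA dB Ax Bx; exists (A `&` B); split=> //; exact: Delta11I. Qed.

HB.instance Definition _ := @isBaseTopological.Build baire_Delta
  (set baire_Delta) Delta11 id Delta_cover Delta_join.

Definition SigmaDelta_basic (A : set baire) : Prop :=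
  Sigma11 A /\ closed (A : set baire_Delta).

Definition baire_SigmaDelta : Type := baire.

HB.instance Definition _ := gen_eqMixin baire_SigmaDelta.
HB.instance Definition _ := gen_choiceMixin baire_SigmaDelta.

Lemma SigmaDelta_cover :
  \bigcup_(A in SigmaDelta_basic) A = [set: baire_SigmaDelta].
Proof.
apply/seteqP; split=> // x _; exists setT => //.
by split; [exact: Sigma11T|exact: closedT].
Qed.

Lemma SigmaDelta_join (A B : set baire_SigmaDelta) (x : baire_SigmaDelta) :
  SigmaDelta_basic A -> SigmaDelta_basic B -> A x -> B x ->
  exists C : set baire_SigmaDelta, [/\ SigmaDelta_basic C, C x & C `<=` A `&` B].
Proof.
move=> [sA cA] [sB cB] Ax Bx; exists (A `&` B); split=> //.
by split; [exact: Sigma11I|exact: closedI].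
Qed.

HB.instance Definition _ := @isBaseTopological.Build baire_SigmaDelta
  (set baire_SigmaDelta) SigmaDelta_basic id SigmaDelta_cover SigmaDelta_join.

(* The trace of E on the subspace A x A of the product, as a set of points of
   that subspace. *)
Definition restr_sq (T : Type) (E : set (T * T)) (A : set T) :
    set (set_type (A `*` A)) :=
  [set p | E (set_val p)].

Arguments restr_sq {T} E A _.

(* Main.v *)
Require Import Defs.
From mathcomp Require Import all_boot all_order all_algebra.
From mathcomp Require Import all_classical all_reals all_analysis.
From mathcomp Require Import zify.
From Stdlib Require Import RelationClasses.

(** Let [Z] be the set of points with no Delta11 neighbourhood contained in one
    class of [E], and [H] its complement, on which [E] is locally constant.
    Sigma11 sets are given by trees, and two trees can be compared by
    simulations: either the first is simulated by the second or the second by a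
    child of the root of the first.  Both alternatives are Sigma11, and they
    exclude each other unless both trees have branches.  This gives Delta11
    separation of disjoint Sigma11 sets and a Pi11 coding of the Delta11 sets, so
    that [Z], as well as the Delta-closure of any Sigma11 set, is Sigma11.  In
    particular a Sigma11 set that meets the Delta-closure of another one meets
    the latter itself.

    If [E] were not meager on [Z x Z], then, its complement being obtained by the
    Souslin operation from closed sets, that complement would be meager on a
    basic rectangle [U x V] inside [Z x Z].  Since [U] is not contained in one
    class, Harrington's argument applies: take [(x0, x1)] generic among the
    inequivalent pairs of [U] and [y] generic in [V], for Sigma11 conditions.
    Then [(x0, y)] and [(x1, y)] avoid the meager set, so that both [x0] and [x1]
    are equivalent to [y], a contradiction. *)

Local Open Scope classical_set_scope.
Local Open Scope nat_scope.
Set Implicit Arguments.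
Unset Strict Implicit.
Unset Printing Implicit Defensive.

(* The topology library has its own [eval]. *)
Local Notation eval := Defs.eval.

(** * Definability over arbitrary contexts *)

(* The elements of a context are tuples of parameters, [cF] and [cN] the function
   and number environments in which formulas about them are evaluated.  [Tm],
   [Fn], [Ar] and [Si] say that a number, a function, an arithmetical or a
   Sigma11 property is definable uniformly in the parameters. *)
Record ctx := Ctx { car :> Type; cF : car -> seq baire; cN : car -> seq nat }.
Arguments cF {c} _.
Arguments cN {c} _.

Definition extN (c : ctx) : ctx :=
  @Ctx (c * nat) (fun g => cF g.1) (fun g => g.2 :: cN g.1).
Definition extB (c : ctx) : ctx :=
  @Ctx (c * baire) (fun g => g.2 :: cF g.1) (fun g => cN g.1).
Definition ctx1 : ctx := @Ctx baire (fun x => [:: x]) (fun=> [::]).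

Definition Tm (c : ctx) (t : c -> nat) : Prop :=
  exists tau, forall g, eval (cF g) (cN g) tau = t g.
Definition Fn (c : ctx) (f : c -> baire) : Prop :=
  @Tm (extN c) (fun g => f g.1 g.2).
Definition Ar (c : ctx) (P : c -> Prop) : Prop :=
  exists p, forall g, P g <-> sat (cF g) (cN g) p.
Definition Si (c : ctx) (P : c -> Prop) : Prop :=
  exists p, forall g, P g <-> exists w, sat (w :: cF g) (cN g) p.

(** Only terms are substituted into; formulas change context through [Ar_sat]. *)
Fixpoint tsub (s : nat -> term) (r : nat -> nat) (t : term) : term :=
  match t with
  | tVar i => s i
  | tZero => tZero
  | tSucc t1 => tSucc (tsub s r t1)
  | tAdd t1 t2 => tAdd (tsub s r t1) (tsub s r t2)
  | tMul t1 t2 => tMul (tsub s r t1) (tsub s r t2)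
  | tApp i t1 => tApp (r i) (tsub s r t1)
  end.

Lemma eval_tsub fs e fs' e' s r t :
  (forall i, eval fs' e' (s i) = nth 0 e i) ->
  (forall i, nth (fun=> 0) fs' (r i) = nth (fun=> 0) fs i) ->
  eval fs' e' (tsub s r t) = eval fs e t.
Proof.
by move=> hs hr; elim: t => //= [t ->//|t -> u ->//|t -> u ->//|i t ->]; rewrite hr.
Qed.

Section Terms.
Variable c : ctx.
Implicit Types (t u : c -> nat) (f : c -> baire).

Lemma Tm_const n : Tm (c := c) (fun=> n).
Proof. by exists (iter n tSucc tZero) => g; elim: n => //= n ->. Qed.

Lemma Tm_S t : Tm t -> Tm (fun g => (t g).+1).
Proof. by move=> [a ha]; exists (tSucc a) => g /=; rewrite ha. Qed.

Lemma Tm_add t u : Tm t -> Tm u -> Tm (fun g => t g + u g).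
Proof. by move=> [a ha] [b hb]; exists (tAdd a b) => g /=; rewrite ha hb. Qed.

Lemma Tm_mul t u : Tm t -> Tm u -> Tm (fun g => t g * u g).
Proof. by move=> [a ha] [b hb]; exists (tMul a b) => g /=; rewrite ha hb. Qed.

Lemma Tm_var : @Tm (extN c) (fun g => g.2).
Proof. by exists (tVar 0). Qed.

Lemma Tm_wkN t : Tm t -> @Tm (extN c) (fun g => t g.1).
Proof.
move=> [a ha]; exists (tsub (fun i => tVar i.+1) id a) => g.
by rewrite -ha; apply: eval_tsub.
Qed.

Lemma Tm_wkB t : Tm t -> @Tm (extB c) (fun g => t g.1).
Proof.
move=> [a ha]; exists (tsub tVar S a) => g.
by rewrite -ha; apply: eval_tsub.
Qed.

Lemma Tm_app f t : Fn f -> Tm t -> Tm (fun g => f g (t g)).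
Proof.
(* Variable 0 of the term for [f] is its argument; the other variables shift down by one. *)
move=> [a ha] [b hb]; exists (tsub (fun i => if i is j.+1 then tVar j else b) id a) => g.
rewrite -[RHS](ha (g, t g)); apply: eval_tsub => //= -[|i] //=.
Qed.

Lemma Fn_var : @Fn (extB c) (fun g => g.2).
Proof. by exists (tApp 0 (tVar 0)). Qed.

Lemma Fn_wkN f : Fn f -> @Fn (extN c) (fun g => f g.1).
Proof.
move=> [a ha]; exists (tsub (fun i => if i is j.+1 then tVar j.+2 else tVar 0) id a) => g.
by rewrite -[RHS](ha (g.1.1, g.2)); apply: eval_tsub => // -[|i].
Qed.

Lemma Fn_wkB f : Fn f -> @Fn (extB c) (fun g => f g.1).
Proof.
move=> [a ha]; exists (tsub tVar S a) => g.
by rewrite -[RHS](ha (g.1.1, g.2)); apply: eval_tsub.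
Qed.

Lemma Fn_coord i : Fn (fun g : c => nth (fun=> 0) (cF g) i).
Proof. by exists (tApp i (tVar 0)). Qed.

Lemma Tm_coord i : Tm (fun g : c => nth 0 (cN g) i).
Proof. by exists (tVar i). Qed.

End Terms.

Lemma Fn_ctx1 : @Fn ctx1 (fun g => g).
Proof. by exists (tApp 0 (tVar 0)). Qed.

Section Arithmetical.
Variable c : ctx.
Implicit Types (t u : c -> nat) (P Q : c -> Prop).

Lemma Ar_iff P Q : (forall g, P g <-> Q g) -> Ar P -> Ar Q.
Proof. by move=> h [p hp]; exists p => g; rewrite -h. Qed.

Lemma Ar_eq t u : Tm t -> Tm u -> Ar (fun g => t g = u g).
Proof. by move=> [a ha] [b hb]; exists (fEq a b) => g /=; rewrite ha hb. Qed.

Lemma Ar_not P : Ar P -> Ar (fun g => ~ P g).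
Proof. by move=> [p hp]; exists (fNot p) => g /=; rewrite hp. Qed.

Lemma Ar_and P Q : Ar P -> Ar Q -> Ar (fun g => P g /\ Q g).
Proof. by move=> [p hp] [q hq]; exists (fAnd p q) => g /=; rewrite hp hq. Qed.

Lemma Ar_or P Q : Ar P -> Ar Q -> Ar (fun g => P g \/ Q g).
Proof.
move=> hP hQ; have := Ar_not (Ar_and (Ar_not hP) (Ar_not hQ)); apply: Ar_iff => g.
by rewrite not_andE !notE.
Qed.

Lemma Ar_imp P Q : Ar P -> Ar Q -> Ar (fun g => P g -> Q g).
Proof.
move=> hP hQ; have := Ar_or (Ar_not hP) hQ; apply: Ar_iff => g.
by rewrite (implyE (P g)).
Qed.

Lemma Ar_all (P : c -> nat -> Prop) :
  @Ar (extN c) (fun g => P g.1 g.2) -> Ar (fun g => forall n, P g n).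
Proof.
move=> [p hp]; exists (fAll p) => g /=; split=> h n.
  by apply/(hp (g, n)); exact: h.
by apply/(hp (g, n)); exact: h.
Qed.

Lemma Ar_ex (P : c -> nat -> Prop) :
  @Ar (extN c) (fun g => P g.1 g.2) -> Ar (fun g => exists n, P g n).
Proof.
move=> [p hp].
have : @Ar (extN c) (fun g => ~ P g.1 g.2) by exists (fNot p) => g /=; rewrite hp.
move=> /(@Ar_all (fun g n => ~ P g n)) [q hq]; exists (fNot q) => g /=; rewrite -hq.
by rewrite -existsNE; split => -[n hn]; exists n => //; apply/not_notP.
Qed.

End Arithmetical.

Lemma Ar_lt (c : ctx) (t u : c -> nat) : Tm t -> Tm u -> Ar (fun g => t g < u g).
Proof.
move=> ht hu.
have : Ar (fun g => exists n, u g = t g + n.+1).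
  apply: Ar_ex; apply: (@Ar_eq (extN c) (fun g => u g.1) (fun g => t g.1 + g.2.+1)).
    exact: Tm_wkN.
  apply: (@Tm_add (extN c)); first exact: Tm_wkN.
  by apply: (@Tm_S (extN c)); exact: Tm_var.
by apply: Ar_iff => g; split=> [[n ->]|h]; [lia|exists (u g - (t g).+1); lia].
Qed.

(** A polynomial, hence a term of the language; it is injective but not onto. *)
Definition J (a b : nat) : nat := (a + b) * (a + b) + a.
Arguments J : simpl never.

(** With [s = a + b], the value [s * s + a] is at least the square of [s] and below that of [s + 1],
    so it determines [s]. *)
Lemma J_inj a b a' b' : J a b = J a' b' -> a = a' /\ b = b'.
Proof. rewrite /J => h; suff : a + b = a' + b' by nia. nia. Qed.

Lemma Tm_J (c : ctx) (t u : c -> nat) : Tm t -> Tm u -> Tm (fun g => J (t g) (u g)).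
Proof.
move=> ht hu; rewrite /J; apply: Tm_add => //.
by apply: Tm_mul; apply: Tm_add.
Qed.

Ltac app_head c f :=
  constr:(fun x : car c =>
    ltac:(let b := eval cbv beta in (f x) in match b with ?h ?a => exact h end)).
Ltac app_arg c f :=
  constr:(fun x : car c =>
    ltac:(let b := eval cbv beta in (f x) in match b with ?h ?a => exact a end)).

(* A term is weakened if putting a dummy value for the last parameter yields a
   convertible term; hence weakening comes before the structural rules. *)
Ltac term_step :=
  first
  [ assumption
  | exact: Tm_var | exact: Fn_var | exact: Fn_ctx1
  | exact: Tm_const
  | match goal with
    | |- @Tm (extN ?c) ?f =>
        refine (@Tm_wkN c (fun x => f (x, 0)) _); cbn beta iota delta [fst snd]
    | |- @Tm (extB ?c) ?f =>
        refine (@Tm_wkB c (fun x => f (x, fun=> 0)) _); cbn beta iota delta [fst snd]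
    | |- @Fn (extN ?c) ?f =>
        refine (@Fn_wkN c (fun x => f (x, 0)) _); cbn beta iota delta [fst snd]
    | |- @Fn (extB ?c) ?f =>
        refine (@Fn_wkB c (fun x => f (x, fun=> 0)) _); cbn beta iota delta [fst snd]
    | |- @Tm ?c (fun g => (@?t g).+1) => apply: (@Tm_S c t)
    | |- @Tm ?c (fun g => @?t g + @?u g) => apply: (@Tm_add c t u)
    | |- @Tm ?c (fun g => @?t g * @?u g) => apply: (@Tm_mul c t u)
    | |- @Tm ?c (fun g => J (@?t g) (@?u g)) => apply: (@Tm_J c t u)
    | |- @Tm ?c ?f =>
        let h := app_head c f in let t := app_arg c f in apply: (@Tm_app c h t)
    | |- @Fn _ (fun g n => _) => unfold Fn; cbn beta iota delta [fst snd]
    end ].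

Ltac ar_step :=
  cbn beta iota delta [fst snd];
  match goal with
  | |- @Ar ?c (fun g => @?t g = @?u g :> nat) => apply: (@Ar_eq c t u)
  | |- @Ar ?c (fun g => ~ @?P g) => apply: (@Ar_not c P)
  | |- @Ar ?c (fun g => @?P g /\ @?Q g) => apply: (@Ar_and c P Q)
  | |- @Ar ?c (fun g => @?P g \/ @?Q g) => apply: (@Ar_or c P Q)
  | |- @Ar ?c (fun g => is_true (@?t g < @?u g)) => apply: (@Ar_lt c t u)
  | |- @Ar ?c (fun g => forall n : nat, @?P g n) => apply: (@Ar_all c P)
  | |- @Ar ?c (fun g => exists n : nat, @?P g n) => apply: (@Ar_ex c P)
  | |- @Ar ?c (fun g => @?P g -> @?Q g) => apply: (@Ar_imp c P Q)
  | _ => term_step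
  end.

Ltac definable := repeat ar_step.

Lemma Tm_eval t (c : ctx) (fs : c -> seq baire) (e : c -> seq nat) :
  (forall i, Fn (fun g => nth (fun=> 0) (fs g) i)) ->
  (forall i, Tm (fun g => nth 0 (e g) i)) ->
  Tm (fun g => eval (fs g) (e g) t).
Proof.
move=> hf he; elim: t => /= [i||t IH|t IHt u IHu|t IHt u IHu|i t IH].
- exact: he.
- exact: Tm_const.
- exact: Tm_S.
- exact: Tm_add.
- exact: Tm_mul.
- exact: (Tm_app (hf i) IH).
Qed.

Lemma Ar_sat p (c : ctx) (fs : c -> seq baire) (e : c -> seq nat) :
  (forall i, Fn (fun g => nth (fun=> 0) (fs g) i)) ->
  (forall i, Tm (fun g => nth 0 (e g) i)) ->
  Ar (fun g => sat (fs g) (e g) p).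
Proof.
elim: p c fs e => /= [t u|p IH|p IHp q IHq|p IH] c fs e hf he.
- by apply: Ar_eq; apply: Tm_eval.
- exact/Ar_not/IH.
- by apply: Ar_and; [apply: IHp|apply: IHq].
- apply: Ar_all; apply: IH => [i|[|i] /=].
  + exact: (Fn_wkN (hf i)).
  + exact: Tm_var.
  + exact: (Tm_wkN (he i)).
Qed.

Lemma Ar_sub (c d : ctx) (h : d -> c) (P : c -> Prop) :
  (forall i, Fn (fun g => nth (fun=> 0) (cF (h g)) i)) ->
  (forall i, Tm (fun g => nth 0 (cN (h g)) i)) ->
  Ar P -> Ar (fun g => P (h g)).
Proof.
move=> hF hN [p hp]; apply: (Ar_iff (P := fun g => sat (cF (h g)) (cN (h g)) p)).
  by move=> g; rewrite hp.
exact: Ar_sat.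
Qed.

(** Assembles a function from its columns. It only builds witnesses and never occurs in a
    formula. *)
Definition unJ (f : nat -> nat -> nat) (m : nat) : nat :=
  xget 0 [set r | exists a b, m = J a b /\ r = f a b].

Lemma unJE f a b : unJ f (J a b) = f a b.
Proof.
rewrite /unJ; case: xgetP => [r -> [a' [b' [/J_inj[-> ->] ->]]]//|].
by move=> /(_ (f a b)); case; exists a, b.
Qed.

(** * Closure properties of Sigma11 *)

Section SigmaClosure.
Variable c : ctx.
Implicit Types P Q : c -> Prop.

Lemma Si_iff P Q : (forall g, P g <-> Q g) -> Si P -> Si Q.
Proof. by move=> h [p hp]; exists p => g; rewrite -h. Qed.

Lemma Si_exB (P : c -> baire -> Prop) :
  @Ar (extB c) (fun g => P g.1 g.2) -> Si (fun g => exists w, P g w).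
Proof.
move=> [p hp]; exists p => g; split=> -[w h]; exists w; move: h;
  by move/(hp (g, w)).
Qed.

Lemma Si_split P : Si P ->
  exists Q : c -> baire -> Prop,
    @Ar (extB c) (fun g => Q g.1 g.2) /\ forall g, P g <-> exists w, Q g w.
Proof.
move=> [p hp]; exists (fun g w => sat (w :: cF g) (cN g) p).
by split=> //; exists p.
Qed.

Lemma Si_Ar P : Ar P -> Si P.
Proof.
move=> hP; apply: (@Si_iff (fun g => exists w : baire, P g)).
  by move=> g; split=> [[]//|h]; exists (fun=> 0).
apply: Si_exB; apply: (@Ar_sub c (extB c) fst) => // i.
  exact: Fn_wkB (Fn_coord c i).
exact: Tm_wkB (Tm_coord c i).
Qed.

End SigmaClosure.

Lemma Ar_subB (c d : ctx) (Q : c -> baire -> Prop) (h : d -> c) (k : d -> baire) :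
  @Ar (extB c) (fun g => Q g.1 g.2) ->
  (forall i, Fn (fun g => nth (fun=> 0) (cF (h g)) i)) ->
  (forall i, Tm (fun g => nth 0 (cN (h g)) i)) -> Fn k ->
  Ar (fun g => Q (h g) (k g)).
Proof.
move=> hQ hF hN hk; apply: (@Ar_sub (extB c) d (fun g => (h g, k g))) hQ => //.
by case.
Qed.

Section SigmaConnectives.
Variable c : ctx.
Implicit Types P Q : c -> Prop.

Let coordsB : (forall i, Fn (fun g : extB c => nth (fun=> 0) (cF g.1) i)) /\
  (forall i, Tm (fun g : extB c => nth 0 (cN g.1) i)).
Proof.
split=> i; first exact: Fn_wkB (Fn_coord c i).
exact: Tm_wkB (Tm_coord c i).
Qed.

Lemma Si_and P Q : Si P -> Si Q -> Si (fun g => P g /\ Q g).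
Proof.
move=> /Si_split[P' [aP hP]] /Si_split[Q' [aQ hQ]].
have [cf cn] := coordsB.
apply: (@Si_iff _ (fun g => exists w,
  P' g (fun n => w (J 0 n)) /\ Q' g (fun n => w (J 1 n)))).
  move=> g; rewrite hP hQ; split=> [[w [h1 h2]]|[[u h1] [v h2]]].
    by split; eexists; eassumption.
  exists (unJ (fun i n => if i is 0 then u n else v n)).
  by split; [move: h1|move: h2]; congr (_ _ _); apply/funext=> n; rewrite unJE.
by apply/Si_exB/Ar_and; apply: Ar_subB => //; definable.
Qed.

Lemma Si_or P Q : Si P -> Si Q -> Si (fun g => P g \/ Q g).
Proof.
move=> /Si_split[P' [aP hP]] /Si_split[Q' [aQ hQ]].
apply: (@Si_iff _ (fun g => exists w, P' g w \/ Q' g w)).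
  move=> g; rewrite hP hQ; split=> [[w []]|[[w]|[w]]] h; [left|right| |];
    by exists w; auto.
exact/Si_exB/Ar_or.
Qed.

Lemma Si_exN (P : c -> nat -> Prop) :
  @Si (extN c) (fun g => P g.1 g.2) -> Si (fun g => exists n, P g n).
Proof.
move=> /Si_split[P' [aP hP]].
apply: (@Si_iff _ (fun g => exists w, exists n, P' (g, n) w)).
  move=> g; split=> [[w [n h]]|[n /(hP (g, n))[w h]]].
    by exists n; apply/(hP (g, n)); exists w.
  by exists w, n.
apply/Si_exB/(@Ar_ex (extB c) (fun g n => P' (g.1, n) g.2)); have [cf cn] := coordsB.
apply: (@Ar_subB (extN c) (extN (extB c)) P' (fun g => (g.1.1, g.2)) (fun g => g.1.2)) => //.
- by move=> i; apply: (Fn_wkN (cf i)).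
- by case=> [|i]; [exact: Tm_var|exact: (Tm_wkN (cn i))].
- by definable.
Qed.

(** Countable choice gathers a witness for each [n] into column [n] of one function. *)
Lemma Si_allN (P : c -> nat -> Prop) :
  @Si (extN c) (fun g => P g.1 g.2) -> Si (fun g => forall n, P g n).
Proof.
move=> /Si_split[P' [aP hP]].
apply: (@Si_iff _ (fun g => exists w, forall n, P' (g, n) (fun m => w (J n m)))).
  move=> g; split=> [[w h] n|h].
    by apply/(hP (g, n)); eexists; exact: h.
  have /choice[w hw] : forall n, exists w, P' (g, n) w by move=> n; apply/(hP (g, n))/h.
  exists (unJ w) => n; move: (hw n); congr (_ _ _).
  by apply/funext=> m; rewrite unJE.
apply/Si_exB/(@Ar_all (extB c) (fun g n => P' (g.1, n) (fun m => g.2 (J n m)))).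
have [cf cn] := coordsB.
apply: (@Ar_subB (extN c) (extN (extB c)) P' (fun g => (g.1.1, g.2))
  (fun g => fun m => g.1.2 (J g.2 m))) => //.
- by move=> i; apply: (Fn_wkN (cf i)).
- by case=> [|i]; [exact: Tm_var|exact: (Tm_wkN (cn i))].
- by definable.
Qed.

Lemma Si_exF (P : c -> baire -> Prop) :
  @Si (extB c) (fun g => P g.1 g.2) -> Si (fun g => exists w, P g w).
Proof.
move=> /Si_split[P' [aP hP]].
apply: (@Si_iff _ (fun g => exists w, P' (g, fun n => w (J 0 n)) (fun n => w (J 1 n)))).
  move=> g; split=> [[w h]|[w /(hP (g, w))[v h]]].
    by eexists; apply/(hP (g, _)); eexists; exact: h.
  exists (unJ (fun i n => if i is 0 then w n else v n)); move: h.
  by congr (P' (g, _) _); apply/funext=> n; rewrite unJE.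
apply: Si_exB; have [cf cn] := coordsB.
apply: (@Ar_subB (extB c) (extB c) P' (fun g => (g.1, fun n => g.2 (J 0 n)))
  (fun g n => g.2 (J 1 n))) => //; last by definable.
by case=> [|i] /=; [definable|exact: cf].
Qed.

End SigmaConnectives.

Lemma Si_Sigma11 (A : set baire) (c : ctx) (x : c -> baire) :
  Sigma11 A -> Fn x -> Si (fun g => A (x g)).
Proof.
move=> [p hp] hx; apply: (@Si_iff _ (fun g => exists w, sat [:: w; x g] [::] p)).
  by move=> g; rewrite hp.
apply/Si_exB/Ar_sat => [[|[|i]]|i] //=; try by definable.
all: by rewrite nth_nil; definable.
Qed.

Lemma Si_Sigma11_2 (A : set (baire * baire)) (c : ctx) (x y : c -> baire) :
  Sigma11_2 A -> Fn x -> Fn y -> Si (fun g => A (x g, y g)).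
Proof.
move=> [p hp] hx hy.
apply: (@Si_iff _ (fun g => exists w, sat [:: w; x g; y g] [::] p)).
  by move=> g; rewrite (hp (_, _)).
apply/Si_exB/Ar_sat => [[|[|[|i]]]|i] //=; try by definable.
all: by rewrite nth_nil; definable.
Qed.

(** * A universal Sigma11 set *)

Fixpoint tcode (t : term) : nat :=
  match t with
  | tVar i => J 0 i
  | tZero => J 1 0
  | tSucc t1 => J 2 (tcode t1)
  | tAdd t1 t2 => J 3 (J (tcode t1) (tcode t2))
  | tMul t1 t2 => J 4 (J (tcode t1) (tcode t2))
  | tApp i t1 => J 5 (J i (tcode t1))
  end.

Fixpoint fcode (p : formula) : nat :=
  match p with
  | fEq t1 t2 => J 0 (J (tcode t1) (tcode t2))
  | fNot p1 => J 1 (fcode p1)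
  | fAnd p1 p2 => J 2 (J (fcode p1) (fcode p2))
  | fAll p1 => J 3 (fcode p1)
  end.

Fixpoint ecode (e : seq nat) : nat := if e is n :: e1 then (J n (ecode e1)).+1 else 0.

Ltac inv_code :=
  repeat match goal with
  | H : J _ _ = J _ _ |- _ =>
      let H1 := fresh in let H2 := fresh in
      case: (J_inj H) => H1 H2 {H}; try discriminate H1
  | H : S _ = S _ |- _ => case: H => H
  | H : 0 = S _ |- _ => discriminate H
  | H : S _ = 0 |- _ => discriminate H
  end.

Lemma tcode_inj : injective tcode.
Proof.
elim=> [i||t IH|t IHt u IHu|t IHt u IHu|i t IH] [i'||t'|t' u'|t' u'|i' t'] //= h;
  inv_code; subst=> //; f_equal; auto.
Qed.

Lemma fcode_inj : injective fcode.
Proof.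
elim=> [t u|p IH|p IHp q IHq|p IH] [t' u'|p'|p' q'|p'] //= h;
  inv_code; f_equal; auto; exact: tcode_inj.
Qed.

Lemma ecode_inj : injective ecode.
Proof.
elim=> [|n e IH] [|n' e'] //= h; inv_code; subst; f_equal; auto.
Qed.

(* A certificate [u] packs a second-order witness [J 3 n |-> w n], a point
   [J 4 n |-> x n], values of terms (tag 0, meaningful where tag 5 is nonzero),
   truth values of formulas (tag 1: 1 for true, 2 for false, anything else for
   no claim) and counterexamples to universal formulas (tag 2), the last four
   indexed by the codes of an expression and of an assignment.  Every claim is
   reduced to claims about immediate subexpressions, so that nothing has to be
   said about numbers that are not codes. *)
Definition tm_ok (u : baire) (i j k e n : nat) : Prop :=
  let v c e := u (J 0 (J c e)) in
  let g c e := u (J 5 (J c e)) in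
  (g (J 0 i) 0 = 0 \/ v (J 0 i) 0 = 0) /\
  (g (J 0 0) (J n e).+1 = 0 \/ v (J 0 0) (J n e).+1 = n) /\
  (g (J 0 i.+1) (J n e).+1 = 0 \/
    g (J 0 i) e <> 0 /\ v (J 0 i.+1) (J n e).+1 = v (J 0 i) e) /\
  (g (J 1 0) e = 0 \/ v (J 1 0) e = 0) /\
  (g (J 2 j) e = 0 \/ g j e <> 0 /\ v (J 2 j) e = (v j e).+1) /\
  (g (J 3 (J j k)) e = 0 \/
    (g j e <> 0 /\ g k e <> 0) /\ v (J 3 (J j k)) e = v j e + v k e) /\
  (g (J 4 (J j k)) e = 0 \/
    (g j e <> 0 /\ g k e <> 0) /\ v (J 4 (J j k)) e = v j e * v k e) /\
  (g (J 5 (J 0 j)) e = 0 \/ g j e <> 0 /\ v (J 5 (J 0 j)) e = u (J 3 (v j e))) /\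
  (g (J 5 (J 1 j)) e = 0 \/ g j e <> 0 /\ v (J 5 (J 1 j)) e = u (J 4 (v j e))) /\
  (g (J 5 (J i.+2 j)) e = 0 \/ v (J 5 (J i.+2 j)) e = 0).

Definition fm_ok (u : baire) (j k e n : nat) : Prop :=
  let v c e := u (J 0 (J c e)) in
  let g c e := u (J 5 (J c e)) in
  let t c e := u (J 1 (J c e)) in
  (t (J 0 (J j k)) e = 1 -> (g j e <> 0 /\ g k e <> 0) /\ v j e = v k e) /\
  (t (J 0 (J j k)) e = 2 -> (g j e <> 0 /\ g k e <> 0) /\ v j e <> v k e) /\
  (t (J 1 j) e = 1 -> t j e = 2) /\
  (t (J 1 j) e = 2 -> t j e = 1) /\
  (t (J 2 (J j k)) e = 1 -> t j e = 1 /\ t k e = 1) /\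
  (t (J 2 (J j k)) e = 2 -> t j e = 2 \/ t k e = 2) /\
  (t (J 3 j) e = 1 -> t j (J n e).+1 = 1) /\
  (t (J 3 j) e = 2 -> t j (J (u (J 2 (J j e))) e).+1 = 2).

(** The last conjunct claims the truth of the formula with code [a] under the empty assignment,
    whose code is 0. For fixed numbers, finitely many values of [u] settle the condition. *)
Definition check (a : nat) (u : baire) (i j k e n : nat) : Prop :=
  tm_ok u i j k e n /\ fm_ok u j k e n /\ u (J 1 (J a 0)) = 1.

Definition certificate (a : nat) (u : baire) : Prop :=
  forall i j k e n, check a u i j k e n.

Definition point (u : baire) : baire := fun n => u (J 4 n).

Definition univ (a : nat) : set baire :=
  [set x | exists2 u, certificate a u & point u = x].

Section Soundness.
Variables (a : nat) (u : baire).
Hypothesis cert : certificate a u.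
Let fs := [:: fun n => u (J 3 n); point u].

Lemma cert_term t e : u (J 5 (J (tcode t) (ecode e))) <> 0 ->
  u (J 0 (J (tcode t) (ecode e))) = eval fs e t.
Proof.
elim: t e => [i||t IH|t IHt s IHs|t IHt s IHs|i t IH] e /= hg.
(* Looking up a variable is a recursion along the assignment. *)
- elim: e i hg => [|n e IHe] i /= hg.
    by have [[h0 _] _] := cert i 0 0 0 0; rewrite nth_nil; case: h0.
  have [[_ [h0 [h1 _]]] _] := cert i.-1 0 0 (ecode e) n.
  case: i hg h0 h1 => [|i] hg /= h0 h1; first by case: h0.
  by case: h1 => // -[/IHe h ->].
- by have [[_ [_ [_ [h _]]]] _] := cert 0 0 0 (ecode e) 0; case: h.
- have [[_ [_ [_ [_ [h _]]]]] _] := cert 0 (tcode t) 0 (ecode e) 0.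
  by case: h => // -[/IH <- ->].
- have [[_ [_ [_ [_ [_ [h _]]]]]] _] := cert 0 (tcode t) (tcode s) (ecode e) 0.
  by case: h => // -[[/IHt <- /IHs <-] ->].
- have [[_ [_ [_ [_ [_ [_ [h _]]]]]]] _] := cert 0 (tcode t) (tcode s) (ecode e) 0.
  by case: h => // -[[/IHt <- /IHs <-] ->].
- have [[_ [_ [_ [_ [_ [_ [_ [h0 [h1 h2]]]]]]]]] _] := cert i.-2 (tcode t) 0 (ecode e) 0.
  case: i hg h0 h1 h2 => [|[|i]] hg /= h0 h1 h2.
  + by case: h0 => // -[/IH <- ->].
  + by case: h1 => // -[/IH <- ->].
  + by rewrite nth_nil; case: h2.
Qed.

(** Both truth values are treated at once because negation exchanges them. *)
Lemma cert_formula p e :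
  (u (J 1 (J (fcode p) (ecode e))) = 1 -> sat fs e p) /\
  (u (J 1 (J (fcode p) (ecode e))) = 2 -> ~ sat fs e p).
Proof.
elim: p e => [t s|p IH|p IHp q IHq|p IH] e /=.
- have [_ [[h1 [h2 _]] _]] := cert 0 (tcode t) (tcode s) (ecode e) 0.
  by split=> [/h1|/h2] [[/cert_term <- /cert_term <-]].
- have [_ [[_ [_ [h1 [h2 _]]]] _]] := cert 0 (fcode p) 0 (ecode e) 0.
  by split=> [/h1 /(IH e).2|/h2 /(IH e).1 h]; last by apply.
- have [_ [[_ [_ [_ [_ [h1 [h2 _]]]]]] _]] := cert 0 (fcode p) (fcode q) (ecode e) 0.
  split=> [/h1[/(IHp e).1 ? /(IHq e).1 ?] //|/h2[/(IHp e).2 h|/(IHq e).2 h]] [] //.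
- split=> [ht n|ht h].
    have [_ [[_ [_ [_ [_ [_ [_ [h1 _]]]]]]] _]] := cert 0 (fcode p) 0 (ecode e) n.
    exact: (IH (n :: e)).1 (h1 ht).
  have [_ [[_ [_ [_ [_ [_ [_ [_ h2]]]]]]] _]] := cert 0 (fcode p) 0 (ecode e) 0.
  by have /(IH (_ :: e)).2 := h2 ht; apply.
Qed.

End Soundness.

Section Completeness.
Variables (w x : baire).
Let fs := [:: w; x].

Let val c e := xget 0 [set r | exists t l, [/\ c = tcode t, e = ecode l & r = eval fs l t]].
Let dom c e : nat := `[< exists t l, c = tcode t /\ e = ecode l >].
Let tru c e := xget 0
  [set r | exists p l, [/\ c = fcode p, e = ecode l & r = if `[< sat fs l p >] then 1 else 2]].
Let cex c e := xget 0
  [set n | exists p l, [/\ c = fcode p, e = ecode l & ~ sat fs (n :: l) p]].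

Let valE t l : val (tcode t) (ecode l) = eval fs l t.
Proof.
rewrite /val; case: xgetP => [r -> [t' [l' [/tcode_inj -> /ecode_inj -> ->]]]//|].
by move=> /(_ (eval fs l t)); case; exists t, l.
Qed.

Let domE t l : dom (tcode t) (ecode l) = 1.
Proof. by rewrite /dom asboolT //; exists t, l. Qed.

Let domP c e : dom c e <> 0 -> exists t l, c = tcode t /\ e = ecode l.
Proof. by rewrite /dom; case: asboolP. Qed.

Let truE p l : tru (fcode p) (ecode l) = if `[< sat fs l p >] then 1 else 2.
Proof.
rewrite /tru; case: xgetP => [r -> [p' [l' [/fcode_inj -> /ecode_inj -> ->]]]//|].
by move=> /(_ (if `[< sat fs l p >] then 1 else 2)); case; exists p, l.
Qed.

Let truP c e : tru c e <> 0 -> exists p l, c = fcode p /\ e = ecode l.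
Proof.
by rewrite /tru; case: xgetP => // r -> [p [l [-> -> _]]] _; exists p, l.
Qed.

Let cexE p l : ~ (forall n, sat fs (n :: l) p) ->
  ~ sat fs (cex (fcode p) (ecode l) :: l) p.
Proof.
move=> /existsNP[n hn]; rewrite /cex; case: xgetP => [r _|].
  by move=> [p' [l' [/fcode_inj -> /ecode_inj -> ?]]].
by move=> /(_ n); case; exists p, l.
Qed.

Let cert_of : baire := unJ (fun tag m =>
  match tag with
  | 0 => unJ val m | 1 => unJ tru m | 2 => unJ cex m
  | 3 => w m | 4 => x m | _ => unJ dom m
  end).

Lemma certificate_complete p : sat fs [::] p ->
  exists2 u, certificate (fcode p) u & point u = x.
Proof.
move=> hp; exists cert_of; last by apply/funext=> n; rewrite /point /cert_of unJE.
move=> i j k e n; rewrite /check /tm_ok /fm_ok /cert_of !unJE.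
have case_dom c e' (P : Prop) : (forall t l, c = tcode t -> e' = ecode l -> P) -> dom c e' = 0 \/ P.
  move=> h; case: (eqVneq (dom c e') 0) => [|/eqP/domP[t [l [ht hl]]]]; first by left.
  by right; apply: h ht hl.
have case_tru c e' r (P : Prop) : r <> 0 ->
    (forall p l, c = fcode p -> e' = ecode l -> tru (fcode p) (ecode l) = r -> P) ->
    tru c e' = r -> P.
  move=> r0 h hr; have : tru c e' <> 0 by rewrite hr.
  by move=> /truP[q [l [hq hl]]]; apply: (h q l) => //; rewrite -hq -hl.
split; [|split].
- do 9?split.
  + apply: case_dom => -[i'||t|t s|t s|i' t] [|n' l] //= hc _; inv_code.
    by rewrite (valE (tVar _) [::]) /= nth_nil.
  + apply: case_dom => -[i'||t|t s|t s|i' t] [|n' l] //= hc he; inv_code; subst.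
    exact: (valE (tVar 0) (_ :: l)).
  + apply: case_dom => -[i'||t|t s|t s|i' t] [|n' l] //= hc he; inv_code; subst.
    by rewrite (domE (tVar i)) (valE (tVar i.+1) (_ :: l)) (valE (tVar i)).
  + apply: case_dom => -[i'||t|t s|t s|i' t] l //= hc he; inv_code; subst.
    exact: (valE tZero).
  + apply: case_dom => -[i'||t|t s|t s|i' t] l //= hc he; inv_code; subst.
    by rewrite domE valE (valE (tSucc t)).
  + apply: case_dom => -[i'||t|t s|t s|i' t] l //= hc he; inv_code; subst.
    by rewrite !domE !valE (valE (tAdd t s)).
  + apply: case_dom => -[i'||t|t s|t s|i' t] l //= hc he; inv_code; subst.
    by rewrite !domE !valE (valE (tMul t s)).
  + apply: case_dom => -[i'||t|t s|t s|i' t] l //= hc he; inv_code; subst.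
    by rewrite !domE !valE (valE (tApp 0 t)).
  + apply: case_dom => -[i'||t|t s|t s|i' t] l //= hc he; inv_code; subst.
    by rewrite !domE !valE (valE (tApp 1 t)).
  + apply: case_dom => -[i'||t|t s|t s|i' t] l //= hc he; inv_code; subst.
    by rewrite (valE (tApp i.+2 t)) /= nth_nil.
- refine (conj _ (conj _ (conj _ (conj _ (conj _ (conj _ (conj _ _))))))).
  + apply: case_tru => // -[t s|q|q r|q] l //= hc -> hr; inv_code; subst.
    by rewrite !domE !valE; move: hr; rewrite (truE (fEq t s)); case: asboolP.
  + apply: case_tru => // -[t s|q|q r|q] l //= hc -> hr; inv_code; subst.
    by rewrite !domE !valE; move: hr; rewrite (truE (fEq t s)); case: asboolP.
  + apply: case_tru => // -[t s|q|q r|q] l //= hc -> hr; inv_code; subst.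
    by move: hr; rewrite (truE (fNot q)) truE; do 2!case: asboolP.
  + apply: case_tru => // -[t s|q|q r|q] l //= hc -> hr; inv_code; subst.
    by move: hr; rewrite (truE (fNot q)) truE; do 2!case: asboolP.
  + apply: case_tru => // -[t s|q|q r|q] l //= hc -> hr; inv_code; subst.
    by move: hr; rewrite (truE (fAnd q r)) !truE; case: asboolP => // -[]; do 2!case: asboolP.
  + apply: case_tru => // -[t s|q|q r|q] l //= hc -> hr; inv_code; subst.
    move: hr; rewrite (truE (fAnd q r)) !truE; case: asboolP => //= nqr _.
    by do 2!case: asboolP => ?; auto; case: nqr.
  + apply: case_tru => // -[t s|q|q r|q] l //= hc -> hr; inv_code; subst.
    by move: hr; rewrite (truE (fAll q)) (truE q (n :: l)); case: asboolP => // h; rewrite asboolT.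
  + apply: case_tru => // -[t s|q|q r|q] l //= hc -> hr; inv_code; subst.
    move: hr; rewrite (truE (fAll q)) (truE q (_ :: l)); case: asboolP => //= h _.
    by rewrite asboolF //; exact: cexE.
- by rewrite (truE p [::]) asboolT.
Qed.

End Completeness.

Lemma Sigma11_univ (A : set baire) : Sigma11 A -> exists a, A = univ a.
Proof.
move=> [p hp]; exists (fcode p); apply/seteqP; split=> x.
  by move=> /hp[w]; exact: certificate_complete.
move=> [u cu <-]; apply/hp; exists (fun n => u (J 3 n)).
by have [_ [_]] := cu 0 0 0 0 0; exact: (cert_formula cu p [::]).1.
Qed.

(** * Continuous dependence on the certificate *)

Definition agree (n : nat) (u v : baire) : Prop := forall i, i < n -> u i = v i.

(** Continuity into the discrete space of numbers; [locP] likewise says that a set is clopen in the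
    usual topology of the Baire space. *)
Definition locN (t : baire -> nat) : Prop :=
  forall u, exists n, forall v, agree n u v -> t v = t u.
Definition locP (P : baire -> Prop) : Prop :=
  forall u, exists n, forall v, agree n u v -> P v <-> P u.

Lemma agree_le m n u v : m <= n -> agree n u v -> agree m u v.
Proof. by move=> mn h i im; apply: h; exact: leq_trans im mn. Qed.

Lemma locN_const k : locN (fun=> k).
Proof. by move=> u; exists 0. Qed.

Lemma locN_app t : locN t -> locN (fun u => u (t u)).
Proof.
move=> h u; have [n hn] := h u; exists (maxn n (t u).+1) => v uv.
rewrite hn; last by apply: agree_le uv; exact: leq_maxl.
by symmetry; apply: uv; exact: leq_maxr.
Qed.

Lemma locN2 (f : nat -> nat -> nat) s t :
  locN s -> locN t -> locN (fun u => f (s u) (t u)).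
Proof.
move=> hs ht u; have [n hn] := hs u; have [m hm] := ht u.
exists (maxn n m) => v uv; rewrite hn ?hm //; apply: agree_le uv.
  exact: leq_maxr.
exact: leq_maxl.
Qed.

Lemma locP_eq s t : locN s -> locN t -> locP (fun u => s u = t u).
Proof.
move=> hs ht u; have [n hn] := hs u; have [m hm] := ht u.
exists (maxn n m) => v uv; rewrite hn ?hm //; apply: agree_le uv.
  exact: leq_maxr.
exact: leq_maxl.
Qed.

Lemma locP_not P : locP P -> locP (fun u => ~ P u).
Proof. by move=> h u; have [n hn] := h u; exists n => v /hn ->. Qed.

Lemma locP_and P Q : locP P -> locP Q -> locP (fun u => P u /\ Q u).
Proof.
move=> hs ht u; have [n hn] := hs u; have [m hm] := ht u.
exists (maxn n m) => v uv; rewrite hn ?hm //; apply: agree_le uv.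
  exact: leq_maxr.
exact: leq_maxl.
Qed.

Lemma locP_or P Q : locP P -> locP Q -> locP (fun u => P u \/ Q u).
Proof.
move=> hs ht u; have [n hn] := hs u; have [m hm] := ht u.
exists (maxn n m) => v uv; rewrite hn ?hm //; apply: agree_le uv.
  exact: leq_maxr.
exact: leq_maxl.
Qed.

Lemma locP_imp P Q : locP P -> locP Q -> locP (fun u => P u -> Q u).
Proof.
move=> hs ht u; have [n hn] := hs u; have [m hm] := ht u.
exists (maxn n m) => v uv; rewrite hn ?hm //; apply: agree_le uv.
  exact: leq_maxr.
exact: leq_maxl.
Qed.

Ltac loc_step :=
  match goal with
  | |- locP (fun u => ~ @?P u) => apply: (@locP_not P)
  | |- locP (fun u => @?P u /\ @?Q u) => apply: (@locP_and P Q)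
  | |- locP (fun u => @?P u \/ @?Q u) => apply: (@locP_or P Q)
  | |- locP (fun u => @?s u = @?t u :> nat) => apply: (@locP_eq s t)
  | |- locP (fun u => @?P u -> @?Q u) => apply: (@locP_imp P Q)
  | _ => exact: locN_const
  | |- locN (fun u => J (@?s u) (@?t u)) => apply: (@locN2 J s t)
  | |- locN (fun u => @?s u + @?t u) => apply: (@locN2 addn s t)
  | |- locN (fun u => @?s u * @?t u) => apply: (@locN2 muln s t)
  | |- locN (fun u => (@?s u).+1) => apply: (@locN2 (fun x _ => x.+1) s s)
  | |- locN (fun u => u (@?t u)) => apply: (@locN_app t)
  end.

Lemma check_loc a i j k e n : locP (fun u => check a u i j k e n).
Proof. by rewrite /check /tm_ok /fm_ok /=; repeat loc_step. Qed.

Lemma check_Ar (c : ctx) (a i j k e n : c -> nat) (u : c -> baire) :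
  Tm a -> Tm i -> Tm j -> Tm k -> Tm e -> Tm n -> Fn u ->
  Ar (fun g => check (a g) (u g) (i g) (j g) (k g) (e g) (n g)).
Proof. by move=> *; rewrite /check /tm_ok /fm_ok /=; definable. Qed.

Lemma certificate_Ar (c : ctx) (a : c -> nat) (u : c -> baire) :
  Tm a -> Fn u -> Ar (fun g => certificate (a g) (u g)).
Proof.
move=> ha hu; rewrite /certificate; do 5!(ar_step; cbn beta iota delta [fst snd]).
by apply: check_Ar; definable.
Qed.

(** * Comparison of trees and separation *)

(** Gödel's beta function, by which two numbers code a finite sequence. *)
Definition beta (c e i : nat) : nat := c %% (i.+1 * e).+1.

(** A common divisor divides [j - i], hence [e], hence 1. *)
Lemma coprime_moduli i j e : i < j -> j - i %| e ->
  coprime (i.+1 * e).+1 (j.+1 * e).+1.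
Proof.
move=> ij jie; rewrite /coprime -dvdn1.
set g := gcdn _ _.
have gi : g %| (i.+1 * e).+1 by exact: dvdn_gcdl.
have gj : g %| (j.+1 * e).+1 by exact: dvdn_gcdr.
have gij : g %| j - i.
  have -> : j - i = j.+1 * (i.+1 * e).+1 - i.+1 * (j.+1 * e).+1 by nia.
  by apply: dvdn_sub; apply: dvdn_mull.
have ge : g %| i.+1 * e by apply/dvdn_mull/(dvdn_trans gij).
by move: gi; rewrite -addn1 dvdn_addr.
Qed.

Lemma beta_dense (u : baire) n : exists c e, agree n (beta c e) u.
Proof.
(* As [s] bounds [n] and the values [u i], the factorial [e] is divisible by all differences of
   indices below [n], and each modulus exceeds the value it has to encode. *)
pose s := n + \sum_(i < n) u i; pose e := s`!.
(* [P] is the product of the moduli already treated; the Chinese remainder theorem adds one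
   congruence at a time. *)
suff : forall m, m <= n -> exists c P,
    [/\ agree m (beta c e) u, (forall i, i < m -> (i.+1 * e).+1 %| P) &
        forall j, m <= j < n -> coprime P (j.+1 * e).+1].
  by move=> /(_ n (leqnn n))[c [P [h _ _]]]; exists c, e.
elim=> [|m IH] mn; first by exists 0, 1; split=> // j _; exact: coprime1n.
have [c [P [h1 h2 h3]]] := IH (ltnW mn).
have cop : coprime P (m.+1 * e).+1 by apply: h3; rewrite leqnn.
exists (chinese P (m.+1 * e).+1 c (u m)), (P * (m.+1 * e).+1); split.
- move=> i; rewrite ltnS leq_eqVlt => /predU1P[->|im].
    rewrite /beta chinese_modr // modn_small //.
    have um : u m <= \sum_(i < n) u i by rewrite (bigD1 (Ordinal mn)) //= leq_addr.
    rewrite ltnS mulSn; apply: leq_trans (leq_addr _ _).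
    apply: leq_trans um _; apply: leq_trans (leq_addl n _) _.
    rewrite -/s /e; elim: (s) => // k IHk; rewrite factS mulSn -addn1 addnC.
    by rewrite leq_add ?fact_gt0 // leq_pmulr ?fact_gt0.
  rewrite -(h1 i im) /beta -(modn_dvdm _ (h2 i im)) chinese_modl //.
  by rewrite modn_dvdm // h2.
- move=> i; rewrite ltnS leq_eqVlt => /predU1P[->|im]; first exact: dvdn_mull.
  by apply: dvdn_mulr; exact: h2.
- move=> j /andP[mj jn]; rewrite coprimeMl h3 ?jn 1?ltnW //=.
  apply: coprime_moduli => //; apply: dvdn_fact; rewrite subn_gt0 mj /=.
  by apply: leq_trans (leq_addr _ _); apply: leq_trans (leq_subr _ _) (ltnW jn).
Qed.

(** * Simulations between trees *)

Section Simulations.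
Variable N : Type.
Implicit Types (E F : N -> N -> Prop) (s t : N).

(** For well-founded relations this says that the rank of [s] is at most that of [t], without
    mentioning ordinals. *)
Definition sim E F s t : Prop :=
  exists2 R : N -> N -> Prop, R s t &
    forall s t, R s t -> forall s', E s s' -> exists2 t', F t t' & R s' t'.

Definition branch E s : Prop :=
  exists f : nat -> N, f 0 = s /\ forall n, E (f n) (f n.+1).

Lemma dependent_choice_on (T : Type) (P : T -> Prop) (R : T -> T -> Prop) x :
  P x -> (forall y, P y -> exists2 z, R y z & P z) ->
  exists f : nat -> T, f 0 = x /\ forall n, P (f n) /\ R (f n) (f n.+1).
Proof.
move=> Px h.
have /choice[nxt hn] : forall y, exists z, P y -> R y z /\ P z.
  move=> y; have [Py|nPy] := pselect (P y); last by exists y.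
  by have [z] := h y Py; exists z.
exists (fun n => iter n nxt x); split=> // n.
suff Pn : forall m, P (iter m nxt x) by split=> //; exact: (hn _ (Pn n)).1.
by elim=> // m IH; exact: (hn _ IH).2.
Qed.

Lemma sim_step E F s t s' : sim E F s t -> E s s' ->
  exists2 t', F t t' & sim E F s' t'.
Proof.
by move=> [R Rst hR] /(hR _ _ Rst)[t' tt' Rs't']; exists t' => //; exists R.
Qed.

(* The pairs [(s, t)] such that no successor of [s] simulates [t] form a
   simulation themselves. *)
Lemma sim_or E F s t : sim E F s t \/ exists2 s', E s s' & sim F E t s'.
Proof.
apply/or_asboolP; rewrite -implyNb; apply/implyP => /asboolPn nsim; apply/asboolP.
apply: contrapT => no; apply: nsim.
exists (fun s t => ~ exists2 s', E s s' & sim F E t s') => //.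
move=> {no} {}s {}t hst s' ss'; apply: contrapT => no; apply: hst; exists s' => //.
(* Similarity unfolded once: a pair is added when each successor of its first node is simulated by
   some successor of the second. *)
exists (fun t s' => sim F E t s' \/
    (forall t', F t t' -> exists2 s'', E s' s'' & sim F E t' s'')).
  right=> t' tt'; apply: contrapT => no'; apply: no; by exists t'.
move=> {}t {ss' no} {}s' [hs|h] t' tt'.
  by have [s'' ? ?] := sim_step hs tt'; exists s'' => //; left.
by have [s'' ? ?] := h t' tt'; exists s'' => //; left.
Qed.

(** Each simulation answers the moves of the other, and the play never ends; with ranks, [s'] would
    be both below [s] and at least as high. *)
Lemma sim_alternate E F s t s' : sim E F s t -> E s s' -> sim F E t s' ->
  branch E s /\ branch F t.
Proof.
move=> st ss' ts'.
pose P (z : N * N) := sim E F z.1 z.2 /\ exists2 s', E z.1 s' & sim F E z.2 s'.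
pose Q (z z' : N * N) := E z.1 z'.1 /\ F z.2 z'.2.
have [||f [f0 hf]] := @dependent_choice_on _ P Q (s, t).
- by split=> //; exists s'.
- move=> [p q] [/= pq [p' pp' qp']].
  have [q' qq' p'q'] := sim_step pq pp'.
  have [p'' ? ?] := sim_step qp' qq'.
  by exists (p', q'); split=> //=; exists p''.
split; [exists (fun n => (f n).1)|exists (fun n => (f n).2)]; rewrite f0; split=> // n;
  by have [_ []] := hf n.
Qed.

Lemma branch_sim E F s t : branch F t -> sim E F s t.
Proof.
move=> [f [f0 hf]]; exists (fun _ t => exists n, t = f n); first by exists 0.
by move=> p _ [n ->] p' _; exists (f n.+1) => //; exists n.+1.
Qed.

Lemma sim_branch E F s t : sim E F s t -> branch E s -> branch F t.
Proof.
move=> [R Rst hR] [f [f0 hf]].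
pose P (z : nat * N) := R (f z.1) z.2.
pose Q (z z' : nat * N) := z'.1 = z.1.+1 /\ F z.2 z'.2.
have [||g [g0 hg]] := @dependent_choice_on _ P Q (0, t).
- by rewrite /P /= f0.
- move=> [n q] /= Rq; have [q' qq' Rq'] := hR _ _ Rq _ (hf n).
  by exists (n.+1, q').
by exists (fun n => (g n).2); rewrite g0; split=> // n; have [_ []] := hg n.
Qed.

End Simulations.

(* The node [(n, c, e)] stands for the initial segment of length [n] of
   [B c e], where [B] is [beta] or a function variable equal to it.  A segment
   is admissible when it can be extended, separately for each clause of
   [certificate] and each value of [x], to a function with that clause. *)
Definition node : Type := (nat * nat * nat)%type.
Definition root : node := (0, 0, 0).

Definition admissible (B : nat -> nat -> baire) a (x : baire) n c e : Prop :=
  forall i j k l m, exists c1 e1, agree n (B c e) (B c1 e1) /\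
    check a (B c1 e1) i j k l m /\ B c1 e1 (J 4 i) = x i.

Definition edge B a x (s s' : node) : Prop :=
  s'.1.1 = s.1.1.+1 /\ agree s.1.1 (B s.1.2 s.2) (B s'.1.2 s'.2) /\
  admissible B a x s'.1.1 s'.1.2 s'.2.

Lemma univ_branch a x : univ a x <-> branch (edge beta a x) root.
Proof.
split=> [[u cu px]|[f [f0 hf]]].
  have /choice[F hF] : forall n, exists z : nat * nat, agree n (beta z.1 z.2) u.
    by move=> n; have [c [e h]] := beta_dense u n; exists (c, e).
  exists (fun n => if n is 0 then root else (n, (F n).1, (F n).2)); split=> // n.
  have adm i : agree n (beta (F n).1 (F n).2) (beta (F (n + i)).1 (F (n + i)).2).
    by move=> j jn; rewrite (hF n) ?(hF (n + i)) //; apply: ltn_addr.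
  split; first by case: n {adm}.
  split; first by case: n adm => // n /(_ 1); rewrite addn1.
  move=> i j k l m /=; have [N hN] := check_loc a i j k l m u.
  (* Long enough to extend the node, to decide the clause, and to contain the position of [x i]. *)
  pose M := n.+1 + (N + (J 4 i).+1).
  exists (F M).1, (F M).2; split.
    by move=> p pn; rewrite (hF n.+1) // (hF M) // ltn_addr.
  split; last by rewrite hF -?px //; rewrite /M; lia.
  apply/hN; last exact: cu.
  by move=> p pN; rewrite (hF M) //; rewrite /M; lia.
have len n : (f n).1.1 = n.
  by elim: n => [|n IH]; [rewrite f0|rewrite (hf n).1 IH].
pose u i := beta (f i.+1).1.2 (f i.+1).2 i.
have hu n : agree n u (beta (f n).1.2 (f n).2).
  elim: n => // n IH i; rewrite ltnS leq_eqVlt => /predU1P[->//|ilt].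
  by rewrite IH //; have [_ []] := hf n; rewrite len => + _; apply.
have adm n : admissible beta a x n.+1 (f n.+1).1.2 (f n.+1).2.
  by have [_ [_]] := hf n; rewrite len.
exists u.
  (* An admissible extension satisfies the clause and agrees with [u] long enough to decide it. *)
  move=> i j k l m; have [N hN] := check_loc a i j k l m u.
  have [c1 [e1 [h [ch _]]]] := adm N i j k l m.
  apply/(hN (beta c1 e1)) => // p pN; rewrite (hu N.+1) ?h // ltnW //.
apply/funext => i; have [c1 [e1 [h [_ <-]]]] := adm (J 4 i) i 0 0 0 0.
by rewrite /point (hu (J 4 i).+1) ?h.
Qed.

Definition oracle (d : baire) (c e : nat) : baire := fun i => d (J (J c e) i).

(** Remainders are not terms, so formulas refer to a function [d] holding the values of [beta],
    specified by division with remainder. *)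
Definition is_beta (d : baire) : Prop :=
  forall c e i, (exists q, c = q * (i.+1 * e).+1 + d (J (J c e) i)) /\
    d (J (J c e) i) < (i.+1 * e).+1.

Lemma is_betaE d : is_beta d -> oracle d = beta.
Proof.
move=> h; apply/funext => c; apply/funext => e; apply/funext => i.
have [[q hq] lt] := h c e i.
by rewrite /beta /oracle [in RHS]hq modnMDl modn_small.
Qed.

Lemma is_beta_ex : exists d, is_beta d.
Proof.
exists (unJ (fun l i => unJ (fun c e => beta c e i) l)) => c e i.
rewrite !unJE; split; last exact: ltn_pmod.
by exists (c %/ (i.+1 * e).+1); exact: divn_eq.
Qed.

Lemma edge_Ar (G : ctx) (a n c e n1 c1 e1 : G -> nat) (d x : G -> baire) :
  Tm a -> Tm n -> Tm c -> Tm e -> Tm n1 -> Tm c1 -> Tm e1 -> Fn d -> Fn x ->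
  Ar (fun g => edge (oracle (d g)) (a g) (x g)
    (n g, c g, e g) (n1 g, c1 g, e1 g)).
Proof.
move=> *; rewrite /edge /admissible /agree /oracle.
repeat first [ar_step | apply: check_Ar].
Qed.

Definition simcode (s t : node) : nat :=
  J (J s.1.1 (J s.1.2 s.2)) (J t.1.1 (J t.1.2 t.2)).

(** The quantifier over relations becomes one over functions [r], whose zeros mark the codes of
    related pairs. *)
Lemma sim_Si (G : ctx) (a b n c e m p q : G -> nat) (x : G -> baire) :
  Tm a -> Tm b -> Fn x -> Tm n -> Tm c -> Tm e -> Tm m -> Tm p -> Tm q ->
  Si (fun g => sim (edge beta (a g) (x g)) (edge beta (b g) (x g))
    (n g, c g, e g) (m g, p g, q g)).
Proof.
move=> ha hb hx hn hc he hm hp hq.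
apply: (@Si_iff _ (fun g => exists d, exists r, is_beta d /\
  r (J (J (n g) (J (c g) (e g))) (J (m g) (J (p g) (q g)))) = 0 /\
  forall n c e m p q, r (J (J n (J c e)) (J m (J p q))) = 0 ->
    forall n1 c1 e1, edge (oracle d) (a g) (x g) (n, c, e) (n1, c1, e1) ->
    exists m1 p1 q1, edge (oracle d) (b g) (x g) (m, p, q) (m1, p1, q1) /\
      r (J (J n1 (J c1 e1)) (J m1 (J p1 q1))) = 0)).
  move=> g; split=> [[d [r [/is_betaE -> [r0 hr]]]]|[R R0 hR]].
    exists (fun s t => r (simcode s t) = 0) => //.
    move=> [[n1 c1] e1] [[m1 p1] q1] /hr{}hr [[n2 c2] e2] /hr[m2 [p2 [q2 [? ?]]]].
    by exists (m2, p2, q2).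
  have [d hd] := is_beta_ex.
  exists d, (unJ (fun s t => ~~ `[< exists s' t', R s' t' /\ J s t = simcode s' t' >])).
  have RE s t : unJ (fun s t => ~~ `[< exists s' t', R s' t' /\ J s t = simcode s' t' >])
      (simcode s t) = 0 <-> R s t.
    rewrite /simcode unJE; split.
      case: asboolP => // -[[[n1 c1] e1] [[[m1 p1] q1] [h]]] eq _; move: h.
      move: s t eq => [[n2 c2] e2] [[m2 p2] q2] /J_inj[] /= /J_inj[-> /J_inj[-> ->]].
      by move=> /J_inj[-> /J_inj[-> ->]].
    by move=> h; rewrite asboolT //; exists s, t.
  rewrite (is_betaE hd); split=> //; split; first exact/(RE (_, _, _) (_, _, _)).
  move=> n1 c1 e1 m1 p1 q1 /(RE (_, _, _) (_, _, _)) /hR{}hR n2 c2 e2 /hR[].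
  by move=> [[m2 p2] q2] h /RE; exists m2, p2, q2.
apply: (@Si_exF G (fun g d => exists r, _)); apply: (@Si_exB (extB G) (fun g r => _)).
rewrite /is_beta; repeat first [ar_step | apply: edge_Ar].
Qed.

(** If a tree with a branch has infinite rank, [lower a b] says that the rank of [a] is at most that
    of [b], and [upper a b] that it is larger; both hold when both ranks are infinite. *)
Definition lower a b : set baire := [set x | sim (edge beta a x) (edge beta b x) root root].

Definition upper a b : set baire :=
  [set x | exists2 s, edge beta a x root s & sim (edge beta b x) (edge beta a x) root s].

Lemma lower_Si (G : ctx) (a b : G -> nat) (x : G -> baire) :
  Tm a -> Tm b -> Fn x -> Si (fun g => lower (a g) (b g) (x g)).
Proof. by move=> *; apply: sim_Si => //; definable. Qed.

Lemma upper_Si (G : ctx) (a b : G -> nat) (x : G -> baire) :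
  Tm a -> Tm b -> Fn x -> Si (fun g => upper (a g) (b g) (x g)).
Proof.
move=> ha hb hx.
apply: (@Si_iff _ (fun g => exists d, is_beta d /\ exists n c e,
  edge (oracle d) (a g) (x g) (0, 0, 0) (n, c, e) /\
  sim (edge beta (b g) (x g)) (edge beta (a g) (x g)) (0, 0, 0) (n, c, e))).
  move=> g; split=> [[d [/is_betaE -> [n [c [e [h1 h2]]]]]]|[[[n c] e] h1 h2]].
    by exists (n, c, e).
  by have [d hd] := is_beta_ex; exists d; rewrite (is_betaE hd); split=> //; exists n, c, e.
apply: (@Si_exF G (fun g d => _)); apply: (@Si_and (extB G)).
  by apply: Si_Ar; rewrite /is_beta; definable.
apply: (@Si_exN (extB G) (fun g n => exists c e, _)).
apply: (@Si_exN (extN (extB G)) (fun g c => exists e, _)).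
apply: (@Si_exN (extN (extN (extB G))) (fun g e => _)).
apply: Si_and; first by apply/Si_Ar/edge_Ar; definable.
by apply: sim_Si; definable.
Qed.

Lemma lower_or_upper a b x : lower a b x \/ upper a b x.
Proof. exact: sim_or. Qed.

Lemma lower_upper a b x : lower a b x -> upper a b x -> univ a x /\ univ b x.
Proof. by move=> h [s' h1 h2]; rewrite !univ_branch; exact: sim_alternate h h1 h2. Qed.

Lemma univ_lower a b x : univ b x -> lower a b x.
Proof. by rewrite univ_branch; exact: branch_sim. Qed.

Lemma lower_univ a b x : lower a b x -> univ a x -> univ b x.
Proof. by rewrite !univ_branch; exact: sim_branch. Qed.

(* Being [decided] is a Pi11 condition on [(a, b)], so a quantification over all
   Delta11 sets [upper a b] costs no more than one over numbers. *)
Definition decided a b : Prop := forall x, ~ (lower a b x /\ upper a b x).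

Lemma decided_Delta11 a b : decided a b -> Delta11 (upper a b).
Proof.
move=> h; split; first by apply: (@upper_Si ctx1) => //; definable.
have -> : ~` upper a b = lower a b.
  apply/seteqP; split=> x; last by move=> ? ?; apply: (h x).
  by have [] := lower_or_upper a b x.
by apply: (@lower_Si ctx1) => //; definable.
Qed.

(** Trees for [D] and for its complement never both have a branch, so comparing them is decided and
    tells which set contains the point. *)
Lemma Delta11_decided D : Delta11 D -> exists a b, decided a b /\ D = upper a b.
Proof.
move=> [/Sigma11_univ[a ha] /Sigma11_univ[b hb]]; exists a, b; split=> [x []|].
  by move=> /lower_upper h /h[]; rewrite -ha -hb => Dx; apply.
apply/seteqP; split=> x.
  move=> Dx; have [l|//] := lower_or_upper a b x.
  have : univ b x by apply: lower_univ l _; rewrite -ha.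
  by rewrite -hb.
move=> ux; apply: contrapT => nD; have : univ b x by rewrite -hb.
by move=> /univ_lower /lower_upper /(_ ux)[]; rewrite -ha.
Qed.

Lemma Delta11C A : Delta11 A -> Delta11 (~` A).
Proof. by move=> [h1 h2]; split=> //; rewrite setCK. Qed.

(** The comparison [upper a b] separates: at most one of the two trees has a branch, and that one
    has the larger rank. *)
Lemma Sigma11_separation A B : Sigma11 A -> Sigma11 B -> A `&` B = set0 ->
  exists D, [/\ Delta11 D, A `<=` D & D `&` B = set0].
Proof.
move=> /Sigma11_univ[a ->] /Sigma11_univ[b ->] AB0.
have no x : ~ (univ a x /\ univ b x) by rewrite -[_ /\ _]/((_ `&` _) x) AB0.
exists (upper a b); split.
- by apply: decided_Delta11 => x [h1 h2]; apply: (no x); exact: lower_upper.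
- move=> x ax; have [l|//] := lower_or_upper a b x.
  by case: (no x); split=> //; exact: lower_univ l ax.
- apply/seteqP; split=> x // -[ux bx]; apply: (no x).
  by apply: lower_upper => //; exact: univ_lower.
Qed.

(** * The Delta-closure of a Sigma11 set *)

Definition dclosure (A : set baire) : set baire :=
  [set x | forall D, Delta11 D -> D x -> exists2 y, D y & A y].

(** For each pair [(a, b)], either it is undecided, or [x] is outside [upper a b], which
    [lower a b x] states positively, or [upper a b] meets [A]. *)
Lemma dclosure_Sigma11 A : Sigma11 A -> Sigma11 (dclosure A).
Proof.
move=> sA; apply: (@Si_iff ctx1 (fun x => forall a b,
  (exists y, lower a b y /\ upper a b y) \/ lower a b x \/
  exists y, upper a b y /\ A y)).
  move=> x; split=> [h D /Delta11_decided[a [b [dab ->]]] Dx|h a b].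
    have [[y ly]|[lx|[y [? ?]]]] := h a b; last by exists y.
      by case: (dab y).
    by case: (dab x).
  have [|nab] := pselect (exists y, lower a b y /\ upper a b y); first by left.
  right; have [|ux] := lower_or_upper a b x; first by left.
  have dab : decided a b by move=> y hy; apply: nab; exists y.
  by right; have [y ? ?] := h _ (decided_Delta11 dab) ux; exists y.
apply: (@Si_allN ctx1 (fun x a => forall b, _)).
apply: (@Si_allN (extN ctx1) (fun x b => _)).
apply: Si_or.
  by apply: (@Si_exF _ (fun g y => _)); apply: Si_and;
    [apply: lower_Si|apply: upper_Si]; definable.
apply: Si_or; first by apply: lower_Si; definable.
apply: (@Si_exF _ (fun g y => _)); apply: Si_and.
  by apply: upper_Si; definable.
by apply: Si_Sigma11 => //; definable.
Qed.

(* A Sigma11 set disjoint from [A] is separated from [A] by a Delta11 set, so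
   it misses the closure of [A] as well. *)
Lemma dclosure_meets A B x : Sigma11 A -> Sigma11 B -> dclosure A x -> B x ->
  exists2 y, A y & B y.
Proof.
move=> sA sB Ax Bx; apply: contrapT => no.
have [|D [dD BD DA]] := Sigma11_separation sB sA.
  by apply/seteqP; split=> // y [By Ay]; apply: no; exists y.
have [y Dy Ay] := Ax D dD (BD _ Bx).
by have : (D `&` A) y by []; rewrite DA.
Qed.

Lemma subset_dclosure A : A `<=` dclosure A.
Proof. by move=> x Ax D _ Dx; exists x. Qed.

(** * Points with no Delta11 neighbourhood inside one class *)

Section Splitting.
Variable E : set (baire * baire).
Hypothesis pE : Pi11_2 E.

Definition rough : set baire :=
  [set x | ~ exists2 D, Delta11 D & D x /\ forall y z, D y -> D z -> E (y, z)].

Lemma rough_Sigma11 : Sigma11 rough.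
Proof.
apply: (@Si_iff ctx1 (fun x => forall a b,
  (exists y, lower a b y /\ upper a b y) \/ lower a b x \/
  exists y, upper a b y /\ exists z, upper a b z /\ (~` E) (y, z))).
  move=> x; split=> [h [D /Delta11_decided[a [b [dab ->]]] [Dx DE]]|h a b].
    have [[y ly]|[lx|[y [uy [z [uz]]]]]] := h a b.
    - by case: (dab y).
    - by case: (dab x).
    - by apply; exact: DE.
  have [|nab] := pselect (exists y, lower a b y /\ upper a b y); first by left.
  right; have [|ux] := lower_or_upper a b x; first by left.
  have dab : decided a b by move=> y hy; apply: nab; exists y.
  right; apply: contrapT => no; apply: h; exists (upper a b); first exact: decided_Delta11.
  by split=> // y z uy uz; apply: contrapT => nE; apply: no; exists y; split=> //; exists z.
apply: (@Si_allN ctx1 (fun x a => forall b, _)).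
apply: (@Si_allN (extN ctx1) (fun x b => _)).
apply: Si_or.
  by apply: (@Si_exF _ (fun g y => _)); apply: Si_and;
    [apply: lower_Si|apply: upper_Si]; definable.
apply: Si_or; first by apply: lower_Si; definable.
apply: (@Si_exF _ (fun g y => _)); apply: Si_and.
  by apply: upper_Si; definable.
apply: (@Si_exF _ (fun g z => _)); apply: Si_and.
  by apply: upper_Si; definable.
by apply: Si_Sigma11_2 => //; definable.
Qed.

Hypothesis eqE : Equivalence (fun x y => E (x, y)).

(** If [U] lay in one class, a Delta11 set separating it from the points inequivalent to some member
    of [U] would be a neighbourhood of [x] inside the class of [x]. *)
Lemma rough_split U x : Sigma11 U -> U `<=` rough -> U x ->
  exists y z, [/\ U y, U z & ~ E (y, z)].
Proof.
move=> sU Ur Ux; apply: contrapT => no.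
have UE y z : U y -> U z -> E (y, z).
  by move=> Uy Uz; apply: contrapT => nE; apply: no; exists y, z.
have sV : Sigma11 [set y | exists z, U z /\ (~` E) (y, z)].
  apply: (@Si_exF ctx1 (fun y z => _)); apply: Si_and.
    by apply: Si_Sigma11 => //; definable.
  by apply: Si_Sigma11_2 => //; definable.
have [|D [dD UD DV]] := Sigma11_separation sU sV.
  by apply/seteqP; split=> // y [Uy [z [Uz]]]; apply; exact: UE.
have DE y : D y -> E (y, x).
  move=> Dy; apply: contrapT => nE.
  by have : (D `&` [set y | exists z, U z /\ (~` E) (y, z)]) y; [split=> //; exists x|rewrite DV].
apply: (Ur x Ux); exists D => //; split; first exact: UD.
move=> y z /DE yx /DE zx.
by have [_ sym trans] := eqE; apply: (trans y x z) => //; exact: sym.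
Qed.

End Splitting.

(** * Baire category *)

Lemma open_DeltaE (A : set baire_Delta) :
  open A <-> forall x, A x -> exists D, [/\ Delta11 D, D x & D `<=` A].
Proof.
split=> [[F sF <-] x [D FD Dx]|h].
  by exists D; split; [exact: sF|by []|move=> y Dy; exists D].
exists [set D | Delta11 D /\ D `<=` A]; first by move=> D [].
apply/seteqP; split=> x; first by move=> [D [_ DA] /DA].
by move=> /h[D [dD Dx DA]]; exists D.
Qed.

Lemma open_SigmaDeltaE (A : set baire_SigmaDelta) :
  open A <-> forall x, A x -> exists B, [/\ SigmaDelta_basic B, B x & B `<=` A].
Proof.
split=> [[F sF <-] x [D FD Dx]|h].
  by exists D; split; [exact: sF|by []|move=> y Dy; exists D].
exists [set D | SigmaDelta_basic D /\ D `<=` A]; first by move=> D [].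
apply/seteqP; split=> x; first by move=> [D [_ DA] /DA].
by move=> /h[D [dD Dx DA]]; exists D.
Qed.

Lemma closed_DeltaE (A : set baire) :
  closed (A : set baire_Delta) <-> dclosure A `<=` A.
Proof.
rewrite -[closed _]/(closed _) -(setCK (A : set baire_Delta)) closedC open_DeltaE setCK.
split=> [h x Ax|h x nAx].
  apply: contrapT => /h[D [dD Dx DA]]; have [y /DA] := Ax D dD Dx; exact.
apply: contrapT => no; apply: nAx; apply: h => D dD Dx.
apply: contrapT => no'; apply: no; exists D; split=> // y Dy Ay.
by apply: no'; exists y.
Qed.

Lemma dclosure_id (A : set baire) : dclosure (dclosure A) `<=` dclosure A.
Proof. by move=> x Ax D dD /(Ax D dD)[y Dy /(_ D dD Dy)]. Qed.

Lemma dclosure_basic A : Sigma11 A -> SigmaDelta_basic (dclosure A).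
Proof.
move=> sA; split; first exact: dclosure_Sigma11.
by apply/closed_DeltaE; exact: dclosure_id.
Qed.

Lemma Delta11_basic D : Delta11 D -> SigmaDelta_basic D.
Proof.
move=> dD; split; first by case: dD.
apply/closed_DeltaE => x Dx; apply: contrapT => nDx.
by have [y] := Dx _ (Delta11C dD) nDx.
Qed.

Definition baire_sq := (baire_SigmaDelta * baire_SigmaDelta)%type.

Lemma open_sqE (A : set baire_sq) :
  open A <-> forall x y, A (x, y) -> exists B C,
    [/\ SigmaDelta_basic B, SigmaDelta_basic C, B x, C y &
        forall x' y', B x' -> C y' -> A (x', y')].
Proof.
split=> [oA x y Axy|h].
  move: oA; rewrite openE => /(_ _ Axy) [[V1 V2] /= [n1 n2] sV].
  move: n1 n2; rewrite !nbhsE => -[G1 [w1 G1x] s1] [G2 [w2 G2y] s2].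
  have [B [bB Bx sB]] := (open_SigmaDeltaE G1).1 w1 x G1x.
  have [C [bC Cy sC]] := (open_SigmaDeltaE G2).1 w2 y G2y.
  by exists B, C; split=> // x' y' /sB/s1 ? /sC/s2 ?; exact: sV.
rewrite openE => -[x y] /h[B [C [bB bC Bx Cy sBC]]].
exists (B, C) => /=; last by move=> [x' y'] [/= ? ?]; exact: sBC.
split; apply: open_nbhs_nbhs; split=> //; apply/open_SigmaDeltaE => z ?.
  by exists B; split.
by exists C; split.
Qed.

(** Indices of sets that are not basic give the empty rectangle, so that every [rect j] is open. *)
Definition rect (j : nat) : set baire_sq :=
  [set p | let: (a, b) := odflt (0, 0) (unpickle j) in
    [/\ SigmaDelta_basic (univ a), SigmaDelta_basic (univ b), univ a p.1 & univ b p.2]].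

Lemma rect_open j : open (rect j).
Proof.
apply/open_sqE => x y; rewrite /rect; case: (odflt _ _) => a b [/= ha hb ax bx].
by exists (univ a), (univ b); split=> // x' y' ? ?; split.
Qed.

Lemma rect_base (O : set baire_sq) p : open O -> O p ->
  exists j, rect j p /\ rect j `<=` O.
Proof.
case: p => x y /open_sqE h /h[B [C [bB bC Bx Cy sBC]]].
have [a ea] := Sigma11_univ bB.1; have [b eb] := Sigma11_univ bC.1.
exists (pickle (a, b)); rewrite /rect pickleK /= -ea -eb; split=> // -[x' y'] [_ _].
exact: sBC.
Qed.

(** * Meager sets and the Souslin operation *)

Section Category.
Variable X : topologicalType.
Implicit Types A B O F : set X.

Lemma nowhere_dense_closed F : closed F ->
  (forall O x, open O -> O `<=` F -> ~ O x) -> nowhere_dense F.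
Proof.
move=> cF h; rewrite /nowhere_dense -(closure_id F).1 //.
apply/seteqP; split=> // x /= Fx; apply: (h _ x (open_interior F)) => //.
exact: interior_subset.
Qed.

Lemma meager_sub A B : A `<=` B -> meager B -> meager A.
Proof. by move=> AB [F [nF BF]]; exists F; split=> //; exact: subset_trans BF. Qed.

Lemma meager_nowhere_dense A : nowhere_dense A -> meager A.
Proof. by move=> nA; exists (fun=> A); split=> // x Ax; exists 0. Qed.

Lemma nowhere_dense0 : nowhere_dense (set0 : set X).
Proof. by rewrite /nowhere_dense closure0 interior0. Qed.

Lemma meager0 : meager (set0 : set X).
Proof. exact/meager_nowhere_dense/nowhere_dense0. Qed.

Lemma meager_bigcup (I : countType) (A : I -> set X) :
  (forall i, meager (A i)) -> meager (\bigcup_i A i).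
Proof.
move=> /choice[F hF].
exists (fun k => if unpickle k is Some (i, n) then F i n else set0); split.
  by move=> k; case: (unpickle k) => [[i n]|]; [exact: (hF i).1|exact: nowhere_dense0].
move=> x [i _ /((hF i).2)[n _ Fx]]; exists (pickle (i, n)) => //.
by rewrite pickleK.
Qed.

Lemma meagerU A B : meager A -> meager B -> meager (A `|` B).
Proof.
move=> mA mB; apply: (@meager_sub _ (\bigcup_(b : bool) if b then A else B)).
  by move=> x [Ax|Bx]; [exists true|exists false].
by apply: meager_bigcup => -[].
Qed.

Lemma nowhere_dense_boundary F : closed F -> nowhere_dense (F `\` F°).
Proof.
move=> cF; apply: nowhere_dense_closed.
  by apply: closedI => //; apply/open_closedC/open_interior.
move=> O x oO OF Ox; have [_] := OF x Ox; apply.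
by have : O `<=` F°; [rewrite -open_subsetE // => y /OF[]|exact].
Qed.

Lemma nowhere_dense_frontier O : open O -> nowhere_dense (closure O `\` O).
Proof.
move=> oO; apply: nowhere_dense_closed.
  by apply: closedI; [exact: closed_closure|exact: open_closedC].
move=> V x oV VO Vx; have [clx _] := VO x Vx.
have [y [Oy Vy]] := clx V (open_nbhs_nbhs (conj oV Vx)).
by have [_] := VO y Vy.
Qed.

Lemma branch_choice (Q : seq nat -> Prop) : Q [::] ->
  (forall s, Q s -> exists n, Q (rcons s n)) -> exists w, forall n, Q (mkseq w n).
Proof.
move=> Q0 h.
have /choice[g hg] : forall s, exists n, Q s -> Q (rcons s n).
  by move=> s; have [/h[n]|] := pselect (Q s); [exists n|exists 0].
pose S n := iter n (fun s => rcons s (g s)) [::].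
exists (fun n => g (S n)) => n.
suff [-> //] : mkseq (fun n => g (S n)) n = S n /\ Q (S n).
elim: n => [|n [IH Qn]]; first by [].
by rewrite /mkseq -addn1 iotaD map_cat /= -/(mkseq _ n) IH cats1 addn1 /=; split=> //; exact: hg.
Qed.

(* Nikodym's argument that the Souslin operation preserves the Baire property,
   in the form of a dichotomy.  [hull s] is the part of the closure of [P s]
   where [P s] is locally nonmeager; up to a meager set it is the union of the
   hulls of the [P (rcons s n)]. *)
Lemma souslin_dichotomy (base : nat -> set X) (P : seq nat -> set X) (W : set X) :
  (forall j, open (base j)) ->
  (forall O x, open O -> O x -> exists j, base j x /\ base j `<=` O) ->
  (forall s x, P s x -> exists n, P (rcons s n) x) -> open W ->
  meager (W `&` [set x | ~ exists w, forall n, closure (P (mkseq w n)) x]) \/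
  exists j, [/\ base j !=set0, base j `<=` W & meager (base j `&` P [::])].
Proof.
move=> oB hB PS oW.
pose thin s := \bigcup_(j in [set j | meager (base j `&` P s)]) base j.
have othin s : open (thin s) by apply: bigcup_open.
pose hull s := closure (P s) `\` thin s.
have chull s : closed (hull s).
  by apply: closedI; [exact: closed_closure|exact: open_closedC].
have P_hull s : meager (P s `\` hull s).
  apply: (@meager_sub _ (\bigcup_j
      if `[< meager (base j `&` P s) >] then base j `&` P s else set0)).
    move=> x [Px nh]; have : thin s x.
      by apply: contrapT => nt; apply: nh; split=> //; exact: subset_closure.
    by move=> [j /= mj Bx]; exists j => //; rewrite asboolT.
  by apply: meager_bigcup => j; case: asboolP => // _; exact: meager0.
have hull_S s : meager (hull s `\` \bigcup_n hull (rcons s n)).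
  pose O := \bigcup_n (hull (rcons s n))°.
  have oO : open O by apply: bigcup_open => n _; exact: open_interior.
  apply: (@meager_sub _ ((hull s `\` (hull s)°) `|` (closure O `\` O))); last first.
    by apply: meagerU; apply: meager_nowhere_dense;
      [exact: nowhere_dense_boundary|exact: nowhere_dense_frontier].
  move=> x [hx nx].
  have [ix|] := pselect ((hull s)° x); last by left.
  right; split; last by move=> [n _ /interior_subset hn]; apply: nx; exists n.
  apply: contrapT => ncl.
  have [||j [Bx jY]] := hB ((hull s)° `&` ~` closure O) x => //.
    by apply: openI; [exact: open_interior|exact/closed_openC/closed_closure].
  (* Away from the interiors of the next hulls, [P s] is covered by meager remainders and
     boundaries, so [base j] is part of [thin s]. *)
  apply: (hx.2); exists j => //=.
  apply: (@meager_sub _ (\bigcup_n ((P (rcons s n) `\` hull (rcons s n)) `|`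
      (hull (rcons s n) `\` (hull (rcons s n))°)))).
    move=> y [/jY[iy ncly] /PS[n Py]]; exists n => //.
    have [hy|] := pselect (hull (rcons s n) y); last by left.
    right; split=> // iny; apply: ncly; apply: subset_closure; by exists n.
  apply: meager_bigcup => n; apply: meagerU => //.
  exact/meager_nowhere_dense/nowhere_dense_boundary.
have [|no] := pselect (exists j, [/\ base j !=set0, base j `<=` W & meager (base j `&` P [::])]).
  by right.
left.
(* A point of [W] outside this hull would yield a basic open subset of [W] on which [P [::]] is
   meager. *)
have W_hull : W `<=` hull [::].
  move=> x Wx; split.
    apply: contrapT => ncl; apply: no.
    have [||j [Bx jW]] := hB (W `&` ~` closure (P [::])) x => //.
      by apply: openI => //; exact/closed_openC/closed_closure.
    exists j; split; first by exists x.
      by move=> y /jW[].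
    apply: meager_sub meager0 => y [/jW[_ nc] Py]; apply: nc; exact: subset_closure.
  move=> [k /= mk kx]; apply: no.
  have [||j [Bx jW]] := hB (W `&` base k) x => //; first exact: openI.
  exists j; split; [by exists x|by move=> y /jW[]|].
  by apply: meager_sub mk => y [/jW[_ ky] Py].
(* Outside these countably many meager sets, every hull containing the point has a successor
   containing it, which gives a path [w]. *)
apply: (@meager_sub _ (\bigcup_s (hull s `\` \bigcup_n hull (rcons s n)))).
  move=> x [Wx nw]; apply: contrapT => nb; apply: nw.
  have [||w hw] := @branch_choice (fun s => hull s x); first exact: W_hull.
    move=> s hs; apply: contrapT => nn; apply: nb; exists s => //; split=> //.
    by move=> [n _ hn]; apply: nn; exists n.
  by exists w => n; have [] := hw n.
by apply: meager_bigcup.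
Qed.

End Category.

(** * Generic points *)

Definition segment (a : nat) (s : seq nat) : set baire :=
  [set x | exists u, [/\ mkseq u (size s) = s, certificate a u & point u = x]].

Lemma univ_segment a : univ a = segment a [::].
Proof.
by apply/seteqP; split=> x [u]; [move=> cu px|move=> [_ cu px]]; exists u.
Qed.

Lemma segment_rcons a s x : segment a s x -> exists n, segment a (rcons s n) x.
Proof.
move=> [u [us cu px]]; exists (u (size s)), u; split=> //.
by rewrite size_rcons mkseqS us.
Qed.

Lemma mkseq_agree u v n : mkseq u n = mkseq v n -> agree n u v.
Proof.
by move=> h i ilt; rewrite -(nth_mkseq 0 u ilt) h nth_mkseq.
Qed.

Lemma prefix_Ar (G : ctx) (u : G -> baire) s : Fn u ->
  Ar (fun g => mkseq (u g) (size s) = s).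
Proof.
move=> hu; elim/last_ind: s => [|s n IH].
  apply: (@Ar_iff _ (fun=> 0 = 0)) => //; by definable.
apply: (@Ar_iff _ (fun g => mkseq (u g) (size s) = s /\ u g (size s) = n)).
  move=> g; rewrite size_rcons mkseqS; split=> [[-> ->] //|/eqP].
  by rewrite eqseq_rcons => /andP[/eqP ? /eqP ?].
by apply: Ar_and => //; definable.
Qed.

Lemma segment_Sigma11 a s : Sigma11 (segment a s).
Proof.
apply: (@Si_iff ctx1 (fun x => exists u, mkseq u (size s) = s /\
  (certificate a u /\ forall n, u (J 4 n) = x n))).
  move=> x; split=> [[u [us [cu px]]]|[u [us cu <-]]]; exists u; split=> //.
  exact/funext.
apply: (@Si_exB ctx1 (fun x u => _)); apply: Ar_and.
  by apply: prefix_Ar; definable.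
apply: Ar_and; first by apply: certificate_Ar; definable.
by definable.
Qed.

(* Each [W k] is [univ a] for some [a]; once the later [W m] are locked into
   longer and longer segments of certificates for [a], these segments converge
   to a certificate that the limit point is in [W k]. *)
Lemma generic_point (W : nat -> set baire) :
  (forall n, W n.+1 `<=` W n) -> (forall n, W n !=set0) ->
  (forall n, Sigma11 (W n)) ->
  (forall a s, exists m, W m `&` segment a s = set0 \/
    exists n, W m `<=` segment a (rcons s n)) ->
  exists x, forall n, W n x.
Proof.
move=> dec ne sW dW.
have mono i j : i <= j -> W j `<=` W i.
  by elim: j => [|j IH]; [rewrite leqn0 => /eqP ->|
    rewrite leq_eqVlt => /predU1P[->//|/IH h] x /dec /h].
have locked k : exists a u, W k = univ a /\ forall j, exists m, W m `<=` segment a (mkseq u j).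
  have [a ea] := Sigma11_univ (sW k).
  have [||u hu] := @branch_choice (fun s => exists m, W m `<=` segment a s).
  - by exists k; rewrite ea univ_segment.
  - move=> s [m ms]; have [m' [h|[n h]]] := dW a s; last by exists n, m'.
    have [x Wx] := ne (maxn m m').
    have : (W m' `&` segment a s) x.
      by split; [|apply: ms]; apply: mono Wx; rewrite ?leq_maxl ?leq_maxr.
    by rewrite h.
  - by exists a, u.
have cert a u : (forall j, exists m, W m `<=` segment a (mkseq u j)) -> certificate a u.
  move=> h i j k l m; have [N hN] := check_loc a i j k l m u.
  have [p Wp] := h N; have [x /Wp[v [/=]]] := ne p.
  by rewrite size_mkseq => /esym/mkseq_agree/hN <- cv _; exact: cv.
have [a0 [u0 [e0 h0]]] := locked 0.
exists (point u0) => k; have [a [u [-> h]]] := locked k.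
exists u; first exact: cert h.
apply/funext => i.
(* A common [x] in a late [W] has certificates for both indices; these agree with [u] and [u0] up to
   position [J 4 i], which holds [x i]. *)
have [m Wm] := h (J 4 i).+1; have [m0 Wm0] := h0 (J 4 i).+1.
have [x Wx] := ne (maxn m m0).
have [] := Wm x (mono _ _ (leq_maxl _ _) x Wx).
move=> v [+ _ vx]; rewrite size_mkseq => /mkseq_agree /(_ (J 4 i) (ltnSn _)) vu.
have [] := Wm0 x (mono _ _ (leq_maxr _ _) x Wx).
move=> v0 [+ _ v0x]; rewrite size_mkseq => /mkseq_agree /(_ (J 4 i) (ltnSn _)) vu0.
by rewrite /point -vu -vu0 -[v _]/(point v i) vx -v0x.
Qed.

Definition evens (z : baire) : baire := fun n => z (n + n).
Definition odds (z : baire) : baire := fun n => z (n + n).+1.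
Definition join (x y : baire) : baire := fun n => if odd n then y n./2 else x n./2.

Lemma evens_join x y : evens (join x y) = x.
Proof. by apply/funext => n; rewrite /evens /join addnn odd_double doubleK. Qed.

Lemma odds_join x y : odds (join x y) = y.
Proof. by apply/funext => n; rewrite /odds /join addnn /= odd_double /= uphalf_double. Qed.

(** The conditions of Gandy-Harrington forcing. *)
Definition condition (W : set baire) : Prop := Sigma11 W /\ W !=set0.

Definition locks (W : set baire) a s : Prop :=
  W `&` segment a s = set0 \/ exists n, W `<=` segment a (rcons s n).

Lemma locks_sub W W' a s : W' `<=` W -> locks W a s -> locks W' a s.
Proof.
move=> sW [h|[n h]]; [left|right].
  by apply/seteqP; split=> // x [/sW Wx sx]; rewrite -h.
by exists n => x /sW /h.
Qed.

Lemma locks_dense W a s : condition W ->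
  exists2 W', condition W' /\ W' `<=` W & locks W' a s.
Proof.
move=> [sW neW]; have [h|] := pselect (W `&` segment a s = set0).
  by exists W; [split|left].
move=> /eqP/set0P[x [Wx /segment_rcons[n sx]]].
exists (W `&` segment a (rcons s n)); last by right; exists n => y [].
split; last by move=> y [].
by split; [apply: Sigma11I => //; exact: segment_Sigma11|exists x].
Qed.

Definition misses (f : baire -> baire) (W B : set baire) (F : set baire_sq) : Prop :=
  forall z y, W z -> B y -> ~ F (f z, y).

(** The Delta-closures of the image of [W] and of [B] span an open rectangle, in which [F] is not
    dense. A basic rectangle avoiding [F] therefore meets it, and by [dclosure_meets] each of its
    sides meets the image or [B] itself. *)
Lemma misses_dense (f : baire -> baire) W B (F : set baire_sq) :
  (forall (G : ctx) (z : G -> baire), Fn z -> Fn (fun g => f (z g))) ->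
  nowhere_dense F -> condition W -> condition B ->
  exists W' B', [/\ condition W', condition B', W' `<=` W, B' `<=` B & misses f W' B' F].
Proof.
move=> ff nF [sW [z0 Wz0]] [sB [y0 By0]].
pose fW := [set x | exists z, W z /\ forall n, x n = f z n].
have sfW : Sigma11 fW.
  apply: (@Si_exF ctx1 (fun x z => _)); apply: Si_and.
    by apply: Si_Sigma11 => //; definable.
  have ? : @Fn (extB ctx1) (fun g => f g.2) by apply: ff; exact: Fn_var.
  by apply: Si_Ar; definable.
pose O : set baire_sq := [set p | dclosure fW p.1 /\ dclosure B p.2].
have oO : open O.
  apply/open_sqE => x y [/= fx By]; exists (dclosure fW), (dclosure B).
  by split=> //; exact: dclosure_basic.
have [p [[p1 p2] np]] : exists p, O p /\ ~ closure F p.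
  apply: contrapT => no.
  have : interior (closure F) (f z0, y0).
    have : O `<=` interior (closure F).
      rewrite -open_subsetE // => p Op; apply: contrapT => np; apply: no.
      by exists p.
    by apply; split; apply: subset_dclosure => //; exists z0.
  by rewrite nF.
case: p p1 p2 np => x y /= fWx By nxy.
have oF : open (~` closure F) by exact/closed_openC/closed_closure.
have [A [C [bA bC Ax Cy AC]]] := (open_sqE _).1 oF x y nxy.
have [_ [z [Wz /funext ->]] Az] := dclosure_meets sfW bA.1 fWx Ax.
have [y' By' Cy'] := dclosure_meets sB bC.1 By Cy.
exists (W `&` [set z | A (f z)]), (B `&` C); split.
- split; last by exists z.
  apply: Sigma11I => //; apply: (@Si_Sigma11 A ctx1); first exact: bA.1.
  by apply: ff; exact: Fn_ctx1.
- by split; [apply: Sigma11I => //; exact: bC.1|exists y'].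
- by move=> ? [].
- by move=> ? [].
- move=> z1 y1 [_ Az1] [_ Cy1] Fzy; apply: (AC _ _ Az1 Cy1).
  exact: subset_closure.
Qed.

Lemma misses_sub f W W' B B' F :
  W' `<=` W -> B' `<=` B -> misses f W B F -> misses f W' B' F.
Proof. by move=> sW sB h z y /sW Wz /sB By; exact: h. Qed.

Lemma generic_pair (W B : set baire) (F : nat -> set baire_sq) :
  condition W -> condition B -> (forall n, nowhere_dense (F n)) ->
  exists z y, [/\ W z, B y & forall n, ~ F n (evens z, y) /\ ~ F n (odds z, y)].
Proof.
move=> cW cB nF.
(* The stage for [(a, s)] locks both conditions at [(a, s)] and makes them miss [F a] through both
   halves of [z]. *)
pose task k : nat * seq nat := odflt (0, [::]) (unpickle k).
pose done_ k (q : set baire * set baire) :=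
  [/\ locks q.1 (task k).1 (task k).2, locks q.2 (task k).1 (task k).2,
      misses evens q.1 q.2 (F (task k).1) & misses odds q.1 q.2 (F (task k).1)].
pose ok (q : set baire * set baire) := condition q.1 /\ condition q.2.
have step k q : ok q -> exists q', [/\ ok q', q'.1 `<=` q.1, q'.2 `<=` q.2 & done_ k q'].
  move: q => [W0 B0] [/= cW0 cB0].
  pose a := (task k).1; pose s := (task k).2.
  have [W1 [cW1 sW1] l1] := locks_dense a s cW0.
  have [B1 [cB1 sB1] l2] := locks_dense a s cB0.
  have [|W2 [B2 [cW2 cB2 sW2 sB2 m1]]] := misses_dense _ (nF a) cW1 cB1 (f := evens).
    by move=> G z hz; rewrite /evens; definable.
  have [|W3 [B3 [cW3 cB3 sW3 sB3 m2]]] := misses_dense _ (nF a) cW2 cB2 (f := odds).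
    by move=> G z hz; rewrite /odds; definable.
  have sW31 : W3 `<=` W1 by exact: subset_trans sW2.
  have sB31 : B3 `<=` B1 by exact: subset_trans sB2.
  exists (W3, B3); split=> //=; try exact: subset_trans sW1; try exact: subset_trans sB1.
  split=> /=; [exact: locks_sub sW31 l1|exact: locks_sub sB31 l2| |exact: m2].
  exact: misses_sub sW3 sB3 m1.
pose P (t : nat * (set baire * set baire)) := ok t.2.
pose R (t t' : nat * (set baire * set baire)) :=
  [/\ t'.1 = t.1.+1, t'.2.1 `<=` t.2.1, t'.2.2 `<=` t.2.2 & done_ t.1 t'.2].
have [||f [f0 hf]] := @dependent_choice_on _ P R (0, (W, B)).
- by [].
- move=> [k q] /(step k)[q' [okq' s1 s2 dq']].
  by exists (k.+1, q').
have fn n : (f n).1 = n.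
  by elim: n => [|n IH]; [rewrite f0|have [_ [-> _ _ _]] := hf n; rewrite IH].
have fd n : done_ n (f n.+1).2 by have [_ [_ _ _]] := hf n; rewrite fn.
have [||||z hz] := @generic_point (fun n => (f n).2.1).
- by move=> n; have [_ []] := hf n.
- by move=> n; have [[[]]] := hf n.
- by move=> n; have [[[]]] := hf n.
- move=> a s; exists (pickle (a, s)).+1.
  by have [+ _ _ _] := fd (pickle (a, s)); rewrite /task pickleK.
have [||||y hy] := @generic_point (fun n => (f n).2.2).
- by move=> n; have [_ []] := hf n.
- by move=> n; have [[_ []]] := hf n.
- by move=> n; have [[_ []]] := hf n.
- move=> a s; exists (pickle (a, s)).+1.
  by have [_ + _ _] := fd (pickle (a, s)); rewrite /task pickleK.
exists z, y; split; [by have := hz 0; rewrite f0|by have := hy 0; rewrite f0|].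
move=> n; have [_ _] := fd (pickle (n, [::] : seq nat)); rewrite /task pickleK /= => m1 m2.
by split; [apply: m1|apply: m2].
Qed.

(** * The decomposition *)

(** Although [x] is arbitrary, only finitely many of its values occur, as numerals, so the set is
    Delta11. *)
Lemma prefix_basic x n : SigmaDelta_basic [set y : baire | forall i, i < n -> y i = x i].
Proof.
have h : Ar (fun y : ctx1 => forall i, i < n -> y i = x i).
  elim: n => [|n IH]; first by apply: (@Ar_iff ctx1 (fun=> 0 = 0)) => //; definable.
  apply: (@Ar_iff ctx1 (fun y => (forall i, i < n -> y i = x i) /\ y n = x n)).
    move=> y; split=> [[h yn] i|h]; last by split=> [i /ltnW|]; apply: h.
    by rewrite ltnS leq_eqVlt => /predU1P[->//|/h].
  by apply: Ar_and => //; definable.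
by apply: Delta11_basic; split; [exact: Si_Ar h|exact: Si_Ar (Ar_not h)].
Qed.

Definition sq_segment (a : nat) (s : seq nat) : set baire_sq :=
  [set p | segment a s (join p.1 p.2)].

(** The closures provide points and certificates arbitrarily close to [x], [y] and [w]; the clauses
    are continuous, so [w] is itself a certificate. *)
Lemma sq_segment_limit a w x y :
  (forall n, closure (sq_segment a (mkseq w n)) (x, y)) -> univ a (join x y).
Proof.
move=> h.
have near n : exists x' y' u, [/\ agree n x' x, agree n y' y, agree n u w,
    certificate a u & point u = join x' y'].
  pose O : set baire_sq := [set p | agree n p.1 x /\ agree n p.2 y].
  have oO : open O.
    apply/open_sqE => x0 y0 [/= ax ay].
    exists [set z | agree n z x], [set z | agree n z y].
    by split=> //; exact: prefix_basic.
  have [|[x' y'] [[u [+ cu pu]] [/= ax ay]]] := h n O.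
    by apply: open_nbhs_nbhs; split=> //; split.
  by rewrite size_mkseq => /mkseq_agree uw; exists x', y', u.
exists w.
  move=> i j k l m; have [N hN] := check_loc a i j k l m w.
  have [x' [y' [u [_ _ uw cu _]]]] := near N.
  by apply/(hN u) => // p pN; rewrite uw.
(* This length covers position [J 4 i] of [w] and position [i./2] of [x] or [y]. *)
apply/funext => i; have [x' [y' [u [ax ay uw _ pu]]]] := near (i + J 4 i).+1.
rewrite /point -uw; last by rewrite ltnS leq_addl.
rewrite -[LHS]/(point u i) pu /join.
by case: ifP => _; [apply: ay|apply: ax]; lia.
Qed.

Section Dichotomy.
Variable E : set (baire * baire).
Hypothesis eqE : Equivalence (fun x y => E (x, y)).
Hypothesis pE : Pi11_2 E.

Let Esym x y : E (x, y) -> E (y, x). Proof. by have [_ s _] := eqE; exact: s. Qed.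
Let Etrans y x z : E (x, y) -> E (y, z) -> E (x, z).
Proof. by have [_ _ t] := eqE; exact: t. Qed.

Let Z : set baire_SigmaDelta := rough E.

Lemma rough_open : open Z.
Proof.
apply/open_SigmaDeltaE => x Zx; exists Z; split=> //; split.
  exact: rough_Sigma11.
apply/closed_DeltaE => y cy [D dD [Dy DE]]; have [z Dz] := cy D dD Dy.
by apply; exists D.
Qed.

Lemma smoothP x : ~ Z x ->
  exists D, [/\ Delta11 D, D x & forall y z, D y -> D z -> E (y, z)].
Proof. by move=> /contrapT[D dD [Dx DE]]; exists D. Qed.

Lemma smooth_open : open (~` Z).
Proof.
apply/open_SigmaDeltaE => x /smoothP[D [dD Dx DE]]; exists D; split=> //.
  exact: Delta11_basic.
by move=> y Dy; apply; exists D.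
Qed.

(** Points outside [Z] have neighbourhoods inside one class, so an invariant set contains a whole
    rectangle around each of its points there. *)
Lemma smooth_saturated_open (P : set (baire * baire)) :
  (forall x x' y y', E (x, x') -> E (y, y') -> P (x, y) -> P (x', y')) ->
  open ((P : set baire_sq) `&` (~` Z `*` ~` Z)).
Proof.
move=> PE; apply/open_sqE => x y [Pxy [/= /smoothP[D [dD Dx DE]] /smoothP[C [dC Cy CE]]]].
exists D, C; split=> //; try exact: Delta11_basic.
move=> x' y' Dx' Cy'; split; first by apply: PE Pxy; [exact: DE|exact: CE].
by split; apply; [exists D|exists C].
Qed.

Lemma not_meager_complement (U V : set baire) :
  Sigma11 U -> Sigma11 V -> U !=set0 -> V !=set0 -> U `<=` Z ->
  ~ meager (((U `*` V) `\` E) : set baire_sq).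
Proof.
move=> sU sV [x0 Ux0] neV UZ [F [nF UVF]].
(* Each [z] codes an inequivalent pair from [U]. *)
pose W := [set z | U (evens z) /\ U (odds z) /\ (~` E) (evens z, odds z)].
have fe : @Fn ctx1 (fun z => evens z) by rewrite /evens; definable.
have fo : @Fn ctx1 (fun z => odds z) by rewrite /odds; definable.
have cW : condition W.
  split.
    apply: (@Si_and ctx1); first exact: Si_Sigma11.
    by apply: (@Si_and ctx1); [exact: Si_Sigma11|exact: Si_Sigma11_2].
  have [y [z [Uy Uz nE]]] := rough_split pE eqE sU UZ Ux0.
  by exists (join y z); rewrite /W /= evens_join odds_join.
have [z [y [[Ue [Uo nE]] Vy miss]]] := generic_pair cW (conj sV neV) nF.
(* Each half of [z] is equivalent to [y], since its pair with [y] avoids every [F n]. *)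
apply: nE; apply: (@Etrans y); last apply: Esym;
  apply: contrapT => nE.
  have [n _ Fn] := UVF (evens z, y) (conj (conj Ue Vy) nE); by have [] := miss n.
have [n _ Fn] := UVF (odds z, y) (conj (conj Uo Vy) nE); by have [] := miss n.
Qed.

Lemma rough_meager : meager ((E : set baire_sq) `&` (Z `*` Z)).
Proof.
have [a ea] : exists a, [set z | (~` E) (evens z, odds z)] = univ a.
  have [a ea] : exists a, [set z | (~` E) (evens z, odds z)] = univ a.
    apply: Sigma11_univ; apply: (@Si_Sigma11_2 _ ctx1) => //.
      by rewrite /evens; definable.
    by rewrite /odds; definable.
  by exists a.
have ea' x y : univ a (join x y) <-> ~ E (x, y).
  by rewrite -ea /= evens_join odds_join.
have oZZ : open (Z `*` Z : set baire_sq).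
  apply/open_sqE => x y [/= Zx Zy].
  have /open_SigmaDeltaE o := rough_open.
  have [B [bB Bx BZ]] := o x Zx; have [C [bC Cy CZ]] := o y Zy.
  by exists B, C; split=> // x' y' /BZ ? /CZ.
have [m|[j [[p jp] jZ mj]]] := souslin_dichotomy (P := sq_segment a) rect_open rect_base
    (fun s p => @segment_rcons a s (join p.1 p.2)) oZZ.
  (* The intersection of the closures along a path is disjoint from [E]. *)
  apply: meager_sub m => -[x y] [Exy ZZ]; split=> // -[w /sq_segment_limit].
  by move=> /ea'; apply.
(* Otherwise the complement of [E] would be meager on a nonempty basic rectangle inside [Z]
   squared. *)
exfalso; move: jp jZ mj; rewrite /rect; case: (odflt _ _) => b c [bb bc bx cy] jZ mj.
apply: (@not_meager_complement (univ b) (univ c)).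
- exact: bb.1.
- exact: bc.1.
- by exists p.1.
- by exists p.2.
- by move=> x ux; have [] := jZ (x, p.2) (And4 bb bc ux cy).
apply: meager_sub mj => -[x y] [[/= ux uy] nE]; split; first by split.
by rewrite /sq_segment /= -univ_segment; apply/ea'.
Qed.

End Dichotomy.

Lemma open_set_val (T : topologicalType) (A O : set T) :
  open O -> open (set_val @^-1` O : set (set_type A)).
Proof. by move=> oO; exists O. Qed.

(** Because [A] is open, relatively open sets come from open sets of the whole space contained in
    [A], so the preimages of the closures keep empty interior. *)
Lemma meager_set_val (T : topologicalType) (A M : set T) :
  open A -> meager (M `&` A) -> meager (set_val @^-1` M : set (set_type A)).
Proof.
move=> oA [F [nF MF]].
exists (fun n => set_val @^-1` closure (F n)); split; last first.
  by move=> x Mx; have [|n _ Fn] := MF (set_val x); [split=> //; exact: set_valP|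
    exists n => //; exact: subset_closure].
move=> n; apply: nowhere_dense_closed.
  rewrite -openC; apply: (@open_set_val _ _ (~` closure (F n))).
  exact/closed_openC/closed_closure.
move=> _ x [V oV <-] VF Vx.
have : (V `&` A) (set_val x) by split=> //; exact: set_valP.
have : V `&` A `<=` interior (closure (F n)).
  rewrite -open_subsetE; last exact: openI.
  move=> y [Vy Ay]; exact: (VF (exist _ y (mem_set Ay))).
by rewrite nF => h /h.
Qed.

Theorem theorem2p3 (E : set (baire * baire)) :
  Equivalence (fun x y : baire => E (x, y)) ->
  Pi11_2 E ->
  exists H Z : set baire_SigmaDelta,
    [/\ H `&` Z = set0, H `|` Z = [set: baire_SigmaDelta],
        clopen H & clopen Z] /\
    clopen (restr_sq (E : set (baire_SigmaDelta * baire_SigmaDelta)) H) /\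
    meager (restr_sq (E : set (baire_SigmaDelta * baire_SigmaDelta)) Z).
Proof.
move=> eqE pE; exists (~` rough E), (rough E).
have oZ := rough_open pE; have oH := @smooth_open E.
have [_ sym trans] := eqE.
split; first split.
- exact: setICl.
- exact: setUCl.
- by split=> //; exact: open_closedC.
- by split=> //; rewrite -openC.
split; last first.
  apply: meager_set_val; last exact: rough_meager.
  apply/open_sqE => x y [/= Zx Zy]; have /open_SigmaDeltaE o := oZ.
  have [B [bB Bx BZ]] := o x Zx; have [C [bC Cy CZ]] := o y Zy.
  by exists B, C; split=> // x' y' /BZ ? /CZ.
(* Applied to [E] and to its complement, this gives both halves of clopenness. *)
have saturated P : (forall x x' y y', E (x, x') -> E (y, y') -> P (x, y) -> P (x', y')) ->
    open (set_val @^-1` (P : set baire_sq) : set (set_type (~` rough E `*` ~` rough E))).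
  move=> /(smooth_saturated_open (E := E)).
  move=> /(@open_set_val _ (~` rough E `*` ~` rough E : set baire_sq)).
  congr open; apply/seteqP; split=> p; first by case.
  by move=> Pp; split=> //; exact: set_valP.
split; first by apply: saturated => x x' y y' /sym x'x yy' xy;
  exact: (trans _ _ _ (trans _ _ _ x'x xy) yy').
rewrite -openC; apply: (saturated (~` E)) => x x' y y' xx' /sym y'y nE x'y'; apply: nE.
exact: (trans _ _ _ (trans _ _ _ xx' x'y') y'y).
Qed.
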